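(* Let $A$ be an even linear operator in a $p|q$-dimensional superspace $V$ over $\mathcal A$, and let $c_k(A)=\operatorname{Tr}\Lambda^kA$ for $k\in\mathbb Z$ (with $c_k(A)=0$ for $k<0$). Then for all integers $k>p-q$, $$\begin{vmatrix}c_k(A)&\dots&c_{k+q}(A)\\ \dots&\dots&\dots\\ c_{k+q}(A)&\dots&c_{k+2q}(A)\end{vmatrix}=0,$$ where the determinant is the Hankel determinant $\det(c_{k+i+j}(A))_{0\le i,j\le q}$.
   Context: Let $\mathcal A=\mathcal A_0\oplus\mathcal A_1$ be a $\mathbb Z_2$-graded supercommutative algebra over $\mathbb C$. A $p|q$-dimensional superspace $V$ means a free $\mathbb Z_2$-graded $\mathcal A$-module of rank $p|q$. An even operator $A$ is given by a block matrix $\begin{pmatrix} A_{00} & A_{01} \\ A_{10} & A_{11} \end{pmatrix}$ with entries of $A_{00}$ ($p\times p$) and $A_{11}$ ($q\times q$) in $\mathcal A_0$ and entries of $A_{01},A_{10}$ in $\mathcal A_1$. $\operatorname{Tr}$ denotes the supertrace, $\operatorname{Tr}A=\operatorname{Tr}A_{00}-\operatorname{Tr}A_{11}$. $\Lambda^kV$ is the $k$-th exterior power in the super sense: the degree-$k$ part of the quotient of the tensor algebra $T(V)$ by the ideal generated by $v\otimes u+(-1)^{\tilde v\tilde u}u\otimes v$ for homogeneous $u,v$ of parities $\tilde u,\tilde v$, with $\mathbb Z_2$-grading inherited from $V$. $\Lambda^kA$ is the induced operator on $\Lambda^kV$. *)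

(* Defs.v *)
From mathcomp Require Import all_boot all_order all_algebra.
From mathcomp Require Import classical_sets reals complex.

Set Implicit Arguments.
Unset Strict Implicit.
Unset Printing Implicit Defensive.

Import GRing.Theory.
Local Open Scope ring_scope.

(* A Z_2-grading A = A_0 (+) A_1 making the K-algebra A supercommutative.
   Parities are booleans (odd = true) added with (+) = addb.  The projections
   [part e] onto A_e are determined by [homog]: see [homog_part], [partD] and
   [homog_direct]. *)
Record supercommutative (K : nzRingType) (A : algType K) := Supercommutative {
  homog : bool -> A -> Prop;
  part : bool -> A -> A;
  homog0 : forall e, homog e 0;
  homogP : forall e (a : K) x y, homog e x -> homog e y -> homog e (a *: x + y);
  homog1 : homog false 1;
  homogM : forall e e' x y,
    homog e x -> homog e' y -> homog (e (+) e') (x * y);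
  homog_part : forall e x, homog e (part e x);
  partD : forall x, part false x + part true x = x;
  homog_direct : forall x, homog false x -> homog true x -> x = 0;
  supercomm : forall e e' x y,
    homog e x -> homog e' y -> x * y = (-1) ^+ (e && e') * (y * x)
}.

(* a |-> (-1)^(d * parity a) a on homogeneous a, extended additively: the sign
   produced when a moves past something of parity d. *)
Definition supersign (K : nzRingType) (A : algType K) (gr : supercommutative A)
    (d : bool) (x : A) : A :=
  if d then part gr false x - part gr true x else x.

(* Parity of the i-th element of a homogeneous basis of a module of rank r|s:
   the first r elements are even, the last s are odd. *)
Definition par r s (i : 'I_(r + s)) : bool := (r <= i)%N.

Definition even_mx (K : nzRingType) (A : algType K) (gr : supercommutative A)
    r s (M : 'M[A]_(r + s)) : Prop :=
  forall i j, homog gr (par i (+) par j) (M i j).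

Definition supertrace (A : nzRingType) r s (M : 'M[A]_(r + s)) : A :=
  \tr (ulsubmx M) - \tr (drsubmx M).

(* V = A^(p|q), with homogeneous basis e_0, ..., e_(p+q-1).  A vector is the
   column of its right coordinates, v = sum_i e_i v_i, so that an operator acts
   by left multiplication by its matrix: M e_j = sum_i e_i M_ij. *)
Section ExteriorPower.
Context {K : nzRingType} {A : algType K} (gr : supercommutative A) {p q : nat}.

Definition vhomog (d : bool) (v : 'cV[A]_(p + q)) : Prop :=
  forall i, homog gr (d (+) par i) (v i 0).

(* The tensor algebra T(V) is the free right A-module on the words
   e_w = e_(w_1) (x) ... (x) e_(w_k).  The function f stands for
   sum_w e_w f(w); it is an element of T(V) when its degree is bounded
   ([in_T]). *)
Definition tensor := seq 'I_(p + q) -> A.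

Definition wpar (w : seq 'I_(p + q)) : bool := odd (count (@par p q) w).

Definition in_T (f : tensor) : Prop :=
  exists N : nat, forall w, (N < size w)%N -> f w = 0.

Definition tdeg (k : nat) (f : tensor) : Prop :=
  forall w, size w != k -> f w = 0.

Definition thomog (d : bool) (f : tensor) : Prop :=
  forall w, homog gr (d (+) wpar w) (f w).

Definition tone : tensor := fun w => (nilp w)%:R.

Definition tvec (v : 'cV[A]_(p + q)) : tensor :=
  fun w => if w is [:: i] then v i 0 else 0.

(* (e_u a) (x) (e_v b) = e_(uv) (-1)^(parity a * parity e_v) a b, summed over
   the factorizations w = uv. *)
Definition tmul (f g : tensor) : tensor := fun w =>
  \sum_(i < (size w).+1)
    supersign gr (wpar (drop i w)) (f (take i w)) * g (drop i w).

Definition ext_gen (g : tensor) : Prop :=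
  exists d d' v u, [/\ vhomog d v, vhomog d' u &
    g = tmul (tvec v) (tvec u)
        \+ (fun w => (-1) ^+ (d && d') * tmul (tvec u) (tvec v) w)].

(* The two-sided ideal of T(V) generated by [ext_gen]. *)
Inductive ext_ideal : tensor -> Prop :=
| ext_ideal0 : ext_ideal (fun=> 0)
| ext_idealD f g : ext_ideal f -> ext_ideal g -> ext_ideal (f \+ g)
| ext_idealM s g t :
    in_T s -> ext_gen g -> in_T t -> ext_ideal (tmul (tmul s g) t).

(* Equality in the quotient of T(V) by the ideal; the k-th exterior power of V
   is the image of the tensors of degree k. *)
Definition ext_eq (f g : tensor) : Prop := ext_ideal (f \- g).

Definition tcomb m (b : 'I_m -> tensor) (x : 'I_m -> A) : tensor :=
  fun w => \sum_i b i w * x i.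

(* The classes of the b_i form a homogeneous basis of the k-th exterior power,
   the first r elements being even and the last s odd. *)
Definition ext_basis (k : nat) r s (b : 'I_(r + s) -> tensor) : Prop :=
  [/\ forall i, tdeg k (b i),
      forall i, thomog (par i) (b i),
      forall x, ext_eq (tcomb b x) (fun=> 0) -> forall i, x i = 0 &
      forall f, tdeg k f -> exists x, ext_eq f (tcomb b x)].

(* The endomorphism T(M) of T(V): it is right A-linear and sends e_w to
   M e_(w_1) (x) ... (x) M e_(w_k).  Since T(M) preserves lengths of words,
   only words of the length of u contribute to the coefficient of e_u. *)
Definition tmap (M : 'M[A]_(p + q)) (f : tensor) : tensor := fun u =>
  \sum_(w : (size u).-tuple 'I_(p + q))
    (\big[tmul/tone]_(j <- w) tvec (col j M)) u * f w.

(* t is the supertrace of the operator induced by T(M) on the k-th exterior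
   power, computed from its matrix N in a homogeneous basis. *)
Definition is_ext_trace (M : 'M[A]_(p + q)) (k : nat) (t : A) : Prop :=
  exists r s (b : 'I_(r + s) -> tensor) (N : 'M[A]_(r + s)),
    [/\ ext_basis k b,
        forall j, ext_eq (tmap M (b j)) (tcomb b (fun i => N i j)) &
        t = supertrace N].

(* The supertrace does not depend on the basis, so the choice made by [xget] is
   immaterial; the default value 0 is not used, as the exterior powers of V are
   free of finite rank over A when 2 is invertible. *)
Definition ext_trace (M : 'M[A]_(p + q)) (k : int) : A :=
  match k with
  | Posz n => xget 0 (is_ext_trace M n)
  | Negz _ => 0
  end.

End ExteriorPower.

(* Main.v *)
Require Import Defs.
From HB Require Import structures.
From mathcomp Require Import all_boot all_order all_algebra.
From mathcomp Require Import classical_sets reals complex.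
From mathcomp Require Import boolp perm zify.

Set Implicit Arguments.
Unset Strict Implicit.
Unset Printing Implicit Defensive.

Import GRing.Theory.
Local Open Scope ring_scope.

(** Write c_k(M) for the supertrace of M on the k-th exterior power.  In the basis
    of sorted words it is a polynomial in the entries of M, homogeneous of degree k,
    and it is invariant under conjugation by even matrices.

    For M diagonal with even entries, the generating function of the c_k is
    prod_i (1 + z l_i) / prod_j (1 + z m_j), with p factors above and q below, so
    that c_k satisfies a linear recurrence with q+1 terms for indices beyond p, and
    the Hankel determinant vanishes.  For general M no such recurrence need hold.
    One passes instead to the matrix D + s M over A[[s]], where
    D = diag(0, 1, 2, ...): since the entries of D are distinct scalars, D + s M is
    diagonalizable over A[[s]] by solving for the conjugating matrix order by order
    in s, so its Hankel determinant vanishes.  As c_k(D + s M) has degree at most k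
    in s, with coefficient c_k(M) at s^k, the coefficient of the top power of s in
    the determinant for D + s M is the determinant for M. *)

(** * Supercommutative algebras *)

(** M itself need not be diagonalizable: A is arbitrary, its odd elements are nilpotent, and solving
    for eigenvectors means dividing by differences of eigenvalues. Taking D as the constant term and
    M as the perturbation makes the nonzero integers i - j the only divisors. The price is that M
    reappears in top degree instead of at s = 0. This works because in the Hankel determinant the
    term of a permutation t has degree bounded by the sum of the k + i + t(i), which is the same for
    all t; negative indices fit in because c vanishes there.

    A is not commutative, so adjugates are used only in the subring of even elements, which contains
    the entries of the diagonal matrix. The exterior power is only given as a quotient; it is
    handled through the projection [nf_mx], and supertraces are sums over all words, so that T(MN) =
    T(M) T(N) applies directly. *)

Section Supercommutative.
Context {K : nzRingType} {A : algType K} (gr : supercommutative A).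
Implicit Types (x y : A) (e d : bool).

Lemma homogD e x y : homog gr e x -> homog gr e y -> homog gr e (x + y).
Proof. by move=> hx hy; have := homogP 1 hx hy; rewrite scale1r. Qed.

Lemma homogN e x : homog gr e x -> homog gr e (- x).
Proof.
by move=> hx; have := homogP (-1) hx (homog0 gr e); rewrite scaleN1r addr0.
Qed.

Lemma homogB e x y : homog gr e x -> homog gr e y -> homog gr e (x - y).
Proof. by move=> hx hy; apply: homogD => //; apply: homogN. Qed.

Lemma homog_sum e (I : Type) (r : seq I) (P : pred I) (F : I -> A) :
  (forall i, P i -> homog gr e (F i)) -> homog gr e (\sum_(i <- r | P i) F i).
Proof.
by move=> hF; elim/big_rec: _ => [|i x Pi hx]; [exact: homog0|apply: homogD; auto].
Qed.

Lemma homog_sign e (b : bool) x : homog gr e x -> homog gr e ((-1) ^+ b * x).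
Proof. by rewrite mulr_sign; case: b => // hx; apply: homogN. Qed.

Lemma homog_nat (n : nat) : homog gr false (n%:R).
Proof.
by elim: n => [|n IHn]; [exact: homog0|rewrite -addn1 natrD; apply: homogD => //;
  exact: homog1].
Qed.

Lemma homog_add_eq0 e x y : homog gr e x -> homog gr (~~ e) y -> x + y = 0 -> x = 0.
Proof.
move=> hx hy /eqP; rewrite addr_eq0 => /eqP xE.
have hx' : homog gr (~~ e) x by rewrite xE; apply: homogN.
by case: e hx hy hx' => /= hx _ hx'; apply: (@homog_direct _ _ gr).
Qed.

Lemma part_negbD e x : part gr e x + part gr (~~ e) x = x.
Proof. by case: e => /=; [rewrite addrC|]; rewrite partD. Qed.

Lemma part_homog e x : homog gr e x -> part gr e x = x.
Proof.
move=> hx; apply/eqP; rewrite eq_sym -subr_eq0; apply/eqP.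
apply: (@homog_add_eq0 e _ (- part gr (~~ e) x)).
- by apply: homogB => //; apply: homog_part.
- by apply: homogN; apply: homog_part.
by rewrite -addrA -opprD part_negbD subrr.
Qed.

Lemma part_homog_neg e x : homog gr e x -> part gr (~~ e) x = 0.
Proof.
move=> hx; have := partD gr x; case: e hx => hx; rewrite (part_homog hx).
  by rewrite -[RHS]add0r => /addIr.
by rewrite -[RHS]addr0 => /addrI.
Qed.

Lemma part_add e x y : part gr e (x + y) = part gr e x + part gr e y.
Proof.
apply/eqP; rewrite -subr_eq0; apply/eqP.
have h e' : homog gr e' (part gr e' (x + y) - (part gr e' x + part gr e' y)).
  by apply: homogB; [|apply: homogD]; apply: homog_part.
apply: (homog_add_eq0 (h e) (h (~~ e))).
by rewrite addrACA -opprD part_negbD addrACA !part_negbD subrr.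
Qed.

Lemma part0 e : part gr e 0 = 0.
Proof. by apply: part_homog; apply: homog0. Qed.

Lemma part_sum e (I : Type) (r : seq I) (P : pred I) (F : I -> A) :
  part gr e (\sum_(i <- r | P i) F i) = \sum_(i <- r | P i) part gr e (F i).
Proof. by rewrite (big_morph (part gr e) (part_add e) (part0 e)). Qed.

Lemma part_mull e d x y : homog gr d x ->
  part gr e (x * y) = x * part gr (d (+) e) y.
Proof.
move=> hx; rewrite -{1}(partD gr y) mulrDr part_add.
have hE e' := homogM hx (homog_part gr e' y).
by case: e d hx hE => [] [] hx hE; do ?[rewrite (part_homog (hE true))];
  do ?[rewrite (part_homog (hE false))];
  do ?[rewrite (part_homog_neg (hE true))]; do ?[rewrite (part_homog_neg (hE false))];
  rewrite ?addr0 ?add0r.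
Qed.

Local Notation ss := (supersign gr).

Lemma supersign_homog d e x : homog gr e x -> ss d x = (-1) ^+ (d && e) * x.
Proof.
rewrite /supersign; case: d => [hx|_]; last by rewrite mul1r.
have hx' := part_homog_neg hx; rewrite mulr_sign.
by case: e hx hx' => hx /= ->; rewrite (part_homog hx) ?sub0r ?subr0.
Qed.

Lemma supersignD d x y : ss d (x + y) = ss d x + ss d y.
Proof. by rewrite /supersign; case: d => //; rewrite !part_add opprD addrACA. Qed.

Lemma supersign0 d : ss d 0 = 0.
Proof. by rewrite (supersign_homog _ (homog0 gr false)) mulr0. Qed.

Lemma supersignN d x : ss d (- x) = - ss d x.
Proof. by apply/eqP; rewrite -addr_eq0 -supersignD addNr supersign0. Qed.

Lemma supersign_signM d (b : bool) x : ss d ((-1) ^+ b * x) = (-1) ^+ b * ss d x.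
Proof. by rewrite !mulr_sign; case: b => //; rewrite supersignN. Qed.

Lemma supersign_sum d (I : Type) (r : seq I) (P : pred I) (F : I -> A) :
  ss d (\sum_(i <- r | P i) F i) = \sum_(i <- r | P i) ss d (F i).
Proof. by rewrite (big_morph (ss d) (supersignD d) (supersign0 d)). Qed.

Lemma supersign_nat d n : ss d n%:R = n%:R.
Proof. by rewrite (supersign_homog _ (homog_nat n)) andbF mul1r. Qed.

Lemma supersign_sign d (b : bool) : ss d ((-1) ^+ b) = (-1) ^+ b.
Proof. by rewrite -[X in ss d X]mulr1 supersign_signM (supersign_nat d 1) mulr1. Qed.

(** [supersign gr true] is the parity automorphism: the rule is checked on homogeneous components,
    where parities add. *)
Lemma supersignM d x y : ss d (x * y) = ss d x * ss d y.
Proof.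
rewrite -(partD gr x) -(partD gr y) !mulrDl !supersignD !mulrDl !mulrDr !supersignD.
have ssMh e1 e2 z t : homog gr e1 z -> homog gr e2 t -> ss d (z * t) = ss d z * ss d t.
  move=> hz ht;
    rewrite (supersign_homog d (homogM hz ht)) (supersign_homog d hz)
      (supersign_homog d ht).
  rewrite !mulr_sign; case: d e1 e2 {hz ht} => [] [] [] //=;
  by rewrite ?mulrN ?mulNr ?opprK.
have h e z := homog_part gr e z.
by rewrite !(ssMh _ _ _ _ (h _ _) (h _ _)).
Qed.

Lemma supersign_comp d e x : ss d (ss e x) = ss (d (+) e) x.
Proof.
rewrite -(partD gr x) !supersignD.
have ssKh e1 z : homog gr e1 z -> ss d (ss e z) = ss (d (+) e) z.
  move=> hz; rewrite (supersign_homog e hz) supersign_signM !(supersign_homog _ hz)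
    mulrA -signr_addb.
  by case: d e e1 {hz} => [] [] [].
by rewrite !(ssKh _ _ (homog_part gr _ x)).
Qed.

Lemma homog_supersign d e x : homog gr e x -> homog gr e (ss d x).
Proof. by move=> hx; rewrite (supersign_homog _ hx); apply: homog_sign. Qed.

Lemma mulC_supersign e x y : homog gr e x -> x * y = ss e y * x.
Proof.
move=> hx; rewrite -(partD gr y) supersignD mulrDr mulrDl.
rewrite !(supersign_homog _ (homog_part gr _ y)) -!mulrA.
by rewrite !(supercomm hx (homog_part gr _ y)).
Qed.

(** Cyclicity of the supertrace: exchanging two entries, both of parity [pI i (+) pJ j], costs
    exactly the sign that turns the sign of [i] into that of [j]. The index types differ because
    words will be paired with basis indices. *)
Lemma str_cyclic (I J : finType) (pI : I -> bool) (pJ : J -> bool)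
    (X : I -> J -> A) (Y : J -> I -> A) :
  (forall i j, homog gr (pI i (+) pJ j) (X i j)) ->
  (forall j i, homog gr (pJ j (+) pI i) (Y j i)) ->
  \sum_i (-1) ^+ pI i * (\sum_j X i j * Y j i) =
  \sum_j (-1) ^+ pJ j * (\sum_i Y j i * X i j).
Proof.
move=> hX hY; under eq_bigr do rewrite mulr_sumr.
rewrite exchange_big /=; apply: eq_bigr => j _; rewrite mulr_sumr.
apply: eq_bigr => i _; rewrite (supercomm (hX i j) (hY j i)) mulrA -signr_addb.
by case: (pI i) (pJ j) => [] [].
Qed.

End Supercommutative.

(** * The exterior algebra on sorted words *)

Section TupleSums.
Variables (T : finType) (V : nmodType).
Implicit Types (F : seq T -> V).

Lemma big_tuple0 F : \sum_(w : 0.-tuple T) F w = F [::].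
Proof.
rewrite (big_pred1 [tuple]) // => w.
by symmetry; apply/eqP/val_inj; apply: size0nil; rewrite size_tuple.
Qed.

Lemma big_tupleS n F :
  \sum_(w : n.+1.-tuple T) F w = \sum_i \sum_(w : n.-tuple T) F (i :: w).
Proof.
rewrite pair_big /= (reindex (fun x : T * n.-tuple T => [tuple of x.1 :: x.2])) //=.
exists (fun w => (thead w, [tuple of behead w])) => [[i w] _|w _] /=.
  by congr pair; apply: val_inj.
by rewrite -tuple_eta.
Qed.

Lemma big_tuple_cat m n F :
  \sum_(w : (m + n).-tuple T) F w =
  \sum_(a : m.-tuple T) \sum_(b : n.-tuple T) F (a ++ b).
Proof.
elim: m F => [|m IHm] F.
  by rewrite (big_tuple0 (fun a => \sum_(b : n.-tuple T) F (a ++ b))).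
rewrite (big_tupleS _ F) (big_tupleS _ (fun a => \sum_(b : n.-tuple T) F (a ++ b))).
by apply: eq_bigr => i _; rewrite (IHm (fun w => F (i :: w))).
Qed.

Lemma big_tuple_eq n F (u : seq T) : size u = n ->
  (forall w, w != u -> F w = 0) -> \sum_(w : n.-tuple T) F w = F u.
Proof.
move=> su hF; have [t tE] : exists t : n.-tuple T, tval t = u.
  by case: _ / su; exists (in_tuple u).
rewrite (bigD1 t) //= tE big1 ?addr0 // => w hw; apply: hF.
by apply: contraNneq hw => wu; apply/eqP/val_inj; rewrite /= wu tE.
Qed.

(** Turns a convolution of the shape of [tmul] into independent sums over the left and the right
    factor. *)
Lemma big_tuple_split n (F : seq T -> seq T -> V) :
  \sum_(w : n.-tuple T) \sum_(i < (size w).+1) F (take i w) (drop i w) =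
  \sum_(i < n.+1) \sum_(a : i.-tuple T) \sum_(b : (n - i).-tuple T) F a b.
Proof.
under eq_bigr => w _ do rewrite size_tuple.
rewrite exchange_big /=; apply: eq_bigr => i _.
have hi : (i <= n)%N by rewrite -ltnS.
pose G m := \sum_(w : m.-tuple T) F (take i w) (drop i w).
have -> : \sum_(w : n.-tuple T) F (take i w) (drop i w) = G (i + (n - i))%N.
  by rewrite subnKC.
rewrite /G (big_tuple_cat _ _ (fun w => F (take i w) (drop i w))).
by apply: eq_bigr => a _; apply: eq_bigr => b _;
  rewrite take_size_cat ?drop_size_cat ?size_tuple.
Qed.

End TupleSums.

Lemma addrr_eq0 (K : numFieldType) (A : algType K) (x : A) : x + x = 0 -> x = 0.
Proof.
rewrite -mulr2n -scaler_nat => h.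
by have := congr1 (fun y => 2%:R^-1 *: y) h;
  rewrite /= scalerA scaler0 mulVf ?scale1r // Num.Theory.pnatr_eq0.
Qed.

(** The sum added to its transpose gives zero, and 2 is invertible. *)
Lemma big_antisym (K : numFieldType) (A : algType K) (I : finType) (X : I -> I -> A) :
  (forall i j, X j i = - X i j) -> \sum_i \sum_j X i j = 0.
Proof.
move=> hX; apply: (@addrr_eq0 K); rewrite [X in _ + X]exchange_big /= -big_split /=.
apply: big1 => i _; rewrite -big_split /=; apply: big1 => j _.
by rewrite hX addrC subrr.
Qed.

(** * Alternating functionals and the ideal of the exterior algebra *)

Section Ideal.
Context {K : numFieldType} {A : algType K} (gr : supercommutative A) {p q : nat}.
Local Notation I := 'I_(p + q).
Local Notation word := (seq I).
Local Notation tensor := (@tensor K A p q).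
Local Notation ss := (supersign gr).
Local Notation tmul := (tmul gr).
Local Notation par := (@par p q).
Local Notation wpar := (@wpar p q).
Implicit Types (i j : I) (u v w : word) (f g : tensor).

Lemma wpar_cat u v : wpar (u ++ v) = wpar u (+) wpar v.
Proof. by rewrite /Defs.wpar count_cat oddD. Qed.

Lemma wpar_cons i v : wpar (i :: v) = par i (+) wpar v.
Proof. by rewrite /Defs.wpar /= oddD; case: (par i). Qed.

Definition alternating (h : word -> A) := forall a b i j,
  h (a ++ j :: i :: b) = - ((-1) ^+ (par i && par j) * h (a ++ i :: j :: b)).

(** The symmetry of the coefficients of a generator, opposite in sign to that of an alternating
    functional. *)
Definition supersymmetric2 (g : tensor) := tdeg 2 g /\
  forall i j, g [:: j; i] = (-1) ^+ (par i && par j) * g [:: i; j].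

Lemma tmul_tvec2 (u v : 'cV[A]_(p + q)) w :
  tmul (tvec u) (tvec v) w =
  if w is [:: i; j] then ss (par j) (u i 0) * v j 0 else 0.
Proof.
case: w => [|i [|j [|k w]]] /=.
- by rewrite /Defs.tmul big_ord1 /= mulr0.
- by rewrite /Defs.tmul !big_ord_recl big_ord0 /= !supersign0 mulr0 mul0r !addr0.
- rewrite /Defs.tmul !big_ord_recl big_ord0 /= /bump /= !supersign0 !mul0r addr0
  add0r addr0.
  by rewrite wpar_cons addbF.
rewrite /Defs.tmul; apply: big1 => [] [[|[|m]] hm] _;
  rewrite /= ?supersign0 ?mul0r ?mulr0 //.
Qed.

Lemma ext_gen_supersymmetric g : ext_gen gr g -> supersymmetric2 g.
Proof.
case=> d [d' [v [u [hv hu ->]]]]; split=> [w|i j].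
  by rewrite /= !tmul_tvec2; case: w => [|i [|j [|k w]]] //= _; rewrite mulr0 addr0.
have hvv k : homog gr (d (+) par k) (v k 0) by exact: hv.
have huu k : homog gr (d' (+) par k) (u k 0) by exact: hu.
rewrite /= !tmul_tvec2 !(supersign_homog _ (hvv _)) !(supersign_homog _ (huu _)).
rewrite -!mulrA (supercomm (huu j) (hvv i)) (supercomm (huu i) (hvv j)) !mulr_sign.
by case: d d' (par i) (par j) {hv hu hvv huu} => [] [] [] [] /=;
  rewrite ?opprD ?opprK // addrC.
Qed.

(** In s g t the two letters read by [g] are adjacent. Exchanging them multiplies [h] and [g] by
    opposite signs, so the terms cancel in pairs. *)
Lemma alternating_ideal (h : word -> A) f n : alternating h -> ext_ideal gr f ->
  \sum_(w : n.-tuple I) h w * f w = 0.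
Proof.
move=> alth; elim=> {f} [|f g _ IHf _ IHg|s g t _ /ext_gen_supersymmetric [g2 gs] _].
- by rewrite big1 // => w _; rewrite mulr0.
- by under eq_bigr => w _ do rewrite mulrDr; rewrite big_split /= IHf IHg addr0.
pose F (c b : word) := h (c ++ b) * (ss (wpar b) (tmul s g c) * t b).
have FE (w : n.-tuple I) : h w * tmul (tmul s g) t w =
    \sum_(i < (size w).+1) F (take i w) (drop i w).
  rewrite /Defs.tmul mulr_sumr; apply: eq_bigr => i _.
  by rewrite /F cat_take_drop.
under eq_bigr => w _ do rewrite FE.
rewrite big_tuple_split; apply: big1 => m _.
rewrite exchange_big /=; apply: big1 => b _.
pose G (x y : word) :=
  h ((x ++ y) ++ b) * (ss (wpar b) (ss (wpar y) (s x) * g y) * t b).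
have GE (c : m.-tuple I) : F c b = \sum_(i < (size c).+1) G (take i c) (drop i c).
  rewrite /F /Defs.tmul supersign_sum mulr_suml mulr_sumr; apply: eq_bigr => i _.
  by rewrite /G cat_take_drop.
under eq_bigr => c _ do rewrite GE.
rewrite big_tuple_split; apply: big1 => l _; apply: big1 => x _.
(* [x] is read by [s], the next m - l letters by [g], and [b] by [t]; as [g] has degree 2, only m -
   l = 2 survives. *)
case: (eqVneq (m - l)%N 2%N) => [->|ml]; last first.
  by apply: big1 => y _; rewrite /G g2 ?size_tuple // mulr0 supersign0 mul0r mulr0.
rewrite (big_tupleS _ (G x)).
under eq_bigr => i _ do rewrite (big_tupleS _ (fun y => G x (i :: y))).
under eq_bigr => i _ do under eq_bigr => j _ do
  rewrite (big_tuple0 (fun y => G x (i :: j :: y))).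
apply: (@big_antisym K) => i j; rewrite /G -!catA /= alth gs.
have -> : wpar [:: j; i] = wpar [:: i; j] by rewrite !wpar_cons addbCA.
rewrite !mulr_sign; case: (_ && _);
  rewrite ?opprK // ?mulrN ?supersignN ?mulNr ?mulrN ?opprK //.
Qed.

End Ideal.

(** * Sorting words with signs *)

Section Sorting.
Context {K : numFieldType} {A : algType K} (gr : supercommutative A) {p q : nat}.
Local Notation I := 'I_(p + q).
Local Notation word := (seq I).
Local Notation tensor := (@tensor K A p q).
Local Notation ss := (supersign gr).
Local Notation tmul := (tmul gr).
Local Notation par := (@par p q).
Local Notation wpar := (@wpar p q).
Implicit Types (i j : I) (a b u v w : word) (f g : tensor) (x y : A).

Definition leI : rel I := fun i j => (i <= j)%N.
Definition sortw w := sort leI w.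

Lemma leI_total : total leI. Proof. by move=> i j; apply: leq_total. Qed.
Lemma leI_trans : transitive leI. Proof. by move=> i j k; apply: leq_trans. Qed.
Lemma leI_anti : antisymmetric leI.
Proof. by move=> i j h; apply/val_inj/anti_leq. Qed.

Lemma perm_sortw w : perm_eq (sortw w) w. Proof. by rewrite perm_sort. Qed.
Lemma size_sortw w : size (sortw w) = size w. Proof. by rewrite size_sort. Qed.
Lemma sortw_sorted w : sorted leI (sortw w). Proof. exact: sort_sorted leI_total _. Qed.
Lemma eq_sortw v w : perm_eq v w -> sortw v = sortw w.
Proof. by move/(perm_sortP leI_total leI_trans leI_anti). Qed.
Lemma sortw_id w : sorted leI w -> sortw w = w.
Proof. exact: sorted_sort leI_trans _. Qed.

Lemma perm_swap2 a b i j : perm_eq (a ++ j :: i :: b) (a ++ i :: j :: b).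
Proof. by rewrite perm_cat2l; apply/seq.permP => P /=; rewrite addnCA. Qed.

Lemma wpar_perm v w : perm_eq v w -> wpar v = wpar w.
Proof. by move/seq.permP => h; rewrite /Defs.wpar h. Qed.

(** Odd letters may repeat: the exterior algebra is symmetric in the odd directions. *)
Definition even_uniq w := uniq (filter (fun i => ~~ par i) w).

Lemma even_uniq_perm v w : perm_eq v w -> even_uniq v = even_uniq w.
Proof. by move=> h; apply: perm_uniq; apply: perm_filter. Qed.

Lemma even_uniq_cons i w : even_uniq (i :: w) = (par i || (i \notin w)) && even_uniq w.
Proof. by rewrite /even_uniq /=; case pi: (par i); rewrite //= mem_filter pi. Qed.

(** Parity of the number of sign changes met when [i] moves right past the smaller letters; two odd
    letters commute and count for nothing. *)
Definition inv_head i w := odd (count (fun j : I => (j < i)%N && ~~ (par i && par j))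
  w).

Fixpoint inv_odd w : bool := if w is i :: v then inv_head i v (+) inv_odd v else false.

(* e_w = sort_sign w * e_(sortw w) in the exterior algebra. *)
Definition sort_sign w : A := (even_uniq w)%:R * (-1) ^+ inv_odd w.

Lemma inv_head_perm i v w : perm_eq v w -> inv_head i v = inv_head i w.
Proof. by move/seq.permP => h; rewrite /inv_head h. Qed.

(** Each letter of [a] sees the same multiset to its right, so only the permuted part changes. *)
Lemma inv_odd_cat_perm a v w : perm_eq v w -> inv_odd (a ++ v) = inv_odd (a ++ w) (+)
  (inv_odd v (+) inv_odd w).
Proof.
move=> h; elim: a => [|i a IH] /=; first by rewrite addbC addbK.
by rewrite IH (@inv_head_perm i (a ++ v) (a ++ w)) ?perm_cat2l // addbA.
Qed.

Lemma inv_head_le i w : all (leI i) w -> inv_head i w = false.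
Proof.
rewrite /inv_head => h; rewrite (eq_in_count (a2 := pred0)) ?count_pred0 // => j jw /=.
by have := allP h _ jw; rewrite /leI ltnNge => ->.
Qed.

Lemma inv_odd_sorted w : sorted leI w -> inv_odd w = false.
Proof.
elim: w => //= i w IH; rewrite path_sortedE; last exact: leI_trans.
by case/andP => /inv_head_le -> /IH ->.
Qed.

Lemma sort_sign_alternating : alternating sort_sign.
Proof.
move=> a b i j; have hp := perm_swap2 a b i j.
rewrite /sort_sign (even_uniq_perm hp) (@inv_odd_cat_perm a (j :: i :: b) (i :: j ::
  b)); last first.
  exact: (perm_swap2 [::]).
(* For equal letters the identity is trivial if [i] is odd; if [i] is even, both sides vanish
   because an even letter is repeated. *)
case: (eqVneq i j) => [<-|nij].
  case pi: (par i); first by rewrite /= mulN1r opprK addbb addbF.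
  suff -> : even_uniq (a ++ i :: i :: b) = false by rewrite !mul0r mulr0 oppr0.
  rewrite /even_uniq filter_cat /= pi /= cat_uniq /= inE eqxx /=.
  by rewrite !andbF.
case: (even_uniq _); last by rewrite !mul0r mulr0 oppr0.
rewrite !mul1r.
(* Exactly one of the two orders is an inversion, and it counts unless both letters are odd. *)
have -> : inv_odd (j :: i :: b) (+) inv_odd (i :: j :: b) = ~~ (par i && par j).
  rewrite /= /inv_head /= !oddD !oddb (andbC (par j)) /=.
  have : (i < j)%N != (j < i)%N by move: nij; rewrite -val_eqE /= neq_ltn; case: ltngtP.
  case: (i < j)%N (j < i)%N => [] [] //= _; case: (_ && _);
  by case: (odd _) (odd _) (inv_odd b) => [] [] [].
by rewrite signr_addb signrN mulrN commr_sign.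
Qed.

Lemma sort_sign_sorted w : sorted leI w -> sort_sign w = (even_uniq w)%:R.
Proof. by move=> h; rewrite /sort_sign inv_odd_sorted // mulr1. Qed.

End Sorting.

(** * Normal forms in the exterior algebra *)

Section NormalForm.
Context {K : numFieldType} {A : algType K} (gr : supercommutative A) {p q : nat}.
Local Notation I := 'I_(p + q).
Local Notation word := (seq I).
Local Notation tensor := (@tensor K A p q).
Local Notation ss := (supersign gr).
Local Notation tmul := (tmul gr).
Local Notation par := (@par p q).
Local Notation wpar := (@wpar p q).
Local Notation alternating := (@alternating K A p q).
Local Notation ideal := (@ext_ideal _ _ gr p q).
Local Notation "f == g '%[ext]'" := (ext_eq gr f g) (at level 70, g at next level).
Implicit Types (i j : I) (a b u v w : word) (f g : tensor) (x y : A).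

Definition tword u x : tensor := fun w => (w == u)%:R * x.

Lemma tword0 u : tword u 0 = fun=> 0.
Proof. by apply: funext => w; rewrite /tword mulr0. Qed.

Lemma in_T_tword u x : in_T (tword u x).
Proof.
exists (size u) => w; case: (eqVneq w u) => [->|/negPf wu _]; first by rewrite ltnn.
by rewrite /tword wu mul0r.
Qed.

Lemma tmul_tword a b x y : tmul (tword a x) (tword b y) = tword (a ++ b) (ss (wpar b)
  x * y).
Proof.
apply: funext => w; rewrite /Defs.tmul /tword.
case: (eqVneq w (a ++ b)) => [->|wab]; last first.
  rewrite mul0r; apply: big1 => i _.
  case: eqP => [ta|_]; last by rewrite mul0r supersign0 mul0r.
  case: eqP => [db|_]; last by rewrite mul0r mulr0.
  by rewrite -(cat_take_drop i w) ta db eqxx in wab.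
have ha : (size a < (size (a ++ b)).+1)%N by rewrite ltnS size_cat leq_addr.
rewrite (bigD1 (Ordinal ha)) //= take_size_cat // drop_size_cat // !eqxx !mul1r.
rewrite big1 ?addr0 // => i ni.
case: eqP => [ta|_]; last by rewrite mul0r supersign0 mul0r.
move: (congr1 size ta); rewrite size_takel; last by rewrite -ltnS.
by move=> ia; case/eqP: ni; apply: val_inj.
Qed.

(** The constructors of the ideal contain no scalar multiples; a right scalar is absorbed by the
    last factor [t]. *)
Lemma ext_idealZ f x : ideal f -> ideal (fun w => f w * x).
Proof.
elim=> {f} [|f g _ IHf _ IHg|s g t hs hg [N ht]].
- by under eq_fun do rewrite mul0r; apply: ext_ideal0.
- have -> : (fun w => (f \+ g) w * x) = (fun w => f w * x) \+ (fun w => g w * x).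
    by apply: funext => w /=; rewrite mulrDl.
  exact: ext_idealD.
have -> : (fun w => tmul (tmul s g) t w * x) = tmul (tmul s g) (fun w => t w * x).
  by apply: funext => w; rewrite /Defs.tmul mulr_suml; under eq_bigr do rewrite -mulrA.
by apply: ext_idealM => //; exists N => w hw; rewrite ht // mul0r.
Qed.

Lemma ext_idealN f : ideal f -> ideal (fun w => - f w).
Proof. by move/(@ext_idealZ _ (-1)); under eq_fun do rewrite mulrN1. Qed.

Lemma ext_eq_refl f : f == f %[ext].
Proof.
rewrite /ext_eq; have -> : f \- f = (fun=> 0) by apply: funext => w /=; rewrite subrr.
exact: ext_ideal0.
Qed.

Lemma ext_eq_sym f g : f == g %[ext] -> g == f %[ext].
Proof. by move/ext_idealN; congr ideal; apply: funext => w /=; rewrite opprB. Qed.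

Lemma ext_eq_trans g f h : f == g %[ext] -> g == h %[ext] -> f == h %[ext].
Proof.
move=> fg gh; have := ext_idealD fg gh; congr ideal.
by apply: funext => w /=; rewrite addrA subrK.
Qed.

Lemma ext_eq_sum (T : Type) (r : seq T) (P : pred T) (F G : T -> tensor) :
  (forall k, P k -> F k == G k %[ext]) ->
  (fun w => \sum_(k <- r | P k) F k w) == (fun w => \sum_(k <- r | P k) G k w) %[ext].
Proof.
move=> h; elim: r => [|k r IH].
  suff -> : (fun w => \sum_(k <- [::] | P k) F k w) =
    (fun w => \sum_(k <- [::] | P k) G k w) by apply: ext_eq_refl.
  by apply: funext => w; rewrite !big_nil.
case hk : (P k); last first.
  by move: IH; congr ext_eq; apply: funext => w; rewrite big_cons hk.
have := ext_idealD (h k hk) IH; congr ideal.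
by apply: funext => w /=; rewrite !big_cons hk opprD addrACA.
Qed.

Lemma ext_eqZ f g x : f == g %[ext] -> (fun w => f w * x) == (fun w => g w * x) %[ext].
Proof. by move/(@ext_idealZ _ x); congr ideal; apply: funext => w /=;
  rewrite mulrBl. Qed.

Lemma tvec_delta i : tvec (delta_mx i 0 : 'cV[A]_(p + q)) = tword [:: i] 1.
Proof.
apply: funext => [[|j [|k w]]]; rewrite /tword /= ?mul0r //.
  by rewrite !mxE eqxx andbT mulr1 eqseq_cons eqxx andbT.
by rewrite eqseq_cons andbF mul0r.
Qed.

Lemma vhomog_delta i : vhomog gr (par i) (delta_mx i 0 : 'cV[A]_(p + q)).
Proof.
move=> j; rewrite mxE eqxx andbT; case: eqP => [->|_]; last exact: homog0.
by rewrite addbb; apply: homog1.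
Qed.

(** The generator is taken at the basis vectors e_j and e_i, then multiplied by e_a on the left and
    by e_b x on the right. *)
Lemma tword_swap a b i j x :
  tword (a ++ j :: i :: b) x == tword (a ++ i :: j :: b) (- ((-1) ^+ (par i && par j)
    * x)) %[ext].
Proof.
have hg : ext_gen gr (tword [:: j; i] 1 \+ tword [:: i; j] ((-1) ^+ (par i && par j))).
  exists (par j), (par i), (delta_mx j 0), (delta_mx i 0).
  split; try exact: vhomog_delta.
  rewrite !tvec_delta !tmul_tword /= !(supersign_nat gr _ 1) !mulr1.
  by apply: funext => w; rewrite /tword [RHS]/= [LHS]/=; congr (_ + _);
    rewrite mulr1 -commr_sign andbC.
have := ext_idealM (in_T_tword a 1) hg (in_T_tword b x); congr ideal.
set g1 := tword [:: j; i] _; set g2 := tword [:: i; j] _.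
have tD f g h : tmul f (g \+ h) = tmul f g \+ tmul f h.
  apply: funext => w; rewrite /= /Defs.tmul -big_split /=.
  by apply: eq_bigr => k _; rewrite mulrDr.
have tDl f g h : tmul (f \+ g) h = tmul f h \+ tmul g h.
  apply: funext => w; rewrite /= /Defs.tmul -big_split /=.
  by apply: eq_bigr => k _; rewrite supersignD mulrDl.
rewrite tD tDl !tmul_tword !(supersign_nat gr _ 1) !mul1r !(supersign_nat gr _ 1)
  -!catA mul1r.
apply: funext => w /=; congr (_ + _).
by rewrite /tword mulrN opprK supersign_sign.
Qed.

(** One step of insertion sort. The prefix [a] varies because each exchange moves a letter of [v]
    into it. *)
Lemma tword_insert v : sorted leI v -> even_uniq v -> forall i a x,
  tword (a ++ i :: v) x == tword (a ++ sortw (i :: v)) (sort_sign (i :: v) * x) %[ext].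
Proof.
elim: v => [|j v IH] sv okv i a x.
  rewrite sortw_id // sort_sign_sorted // even_uniq_cons /= orbT mul1r;
    exact: ext_eq_refl.
have vsort : all (leI j) v && sorted leI v.
  by move: sv; rewrite /= path_sortedE //; apply: leI_trans.
case/andP: vsort => jv sv'.
case: (ltngtP i j) => [ij|ji|/val_inj ij].
- have s' : sorted leI (i :: j :: v) by rewrite /= /leI ltnW //=; move: sv; rewrite /=.
  rewrite sortw_id // sort_sign_sorted // even_uniq_cons okv andbT.
  suff -> : i \notin j :: v by rewrite orbT mul1r; apply: ext_eq_refl.
  rewrite inE -val_eqE /= ltn_eqF //=; apply: contraL ij => /(allP jv).
  by rewrite /leI leqNgt.
- apply: ext_eq_trans (tword_swap a v j i x) _.
  have okv' : even_uniq v by move: okv; rewrite even_uniq_cons => /andP [].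
  have := IH sv' okv' i (rcons a j) (- ((-1) ^+ (par j && par i) * x)).
  rewrite !cat_rcons => h; apply: ext_eq_trans h _.
  have hp := perm_swap2 [::] v j i; rewrite /= in hp.
  have jle : all (leI j) (i :: v) by rewrite /= jv andbT /leI ltnW.
  have -> : sortw (i :: j :: v) = j :: sortw (i :: v).
    rewrite (eq_sortw hp); apply: (sorted_eq leI_trans leI_anti (sortw_sorted _)).
      rewrite /= path_sortedE; last exact: leI_trans.
      by rewrite sortw_sorted andbT (perm_all _ (perm_sortw _)).
    by rewrite (permPl (perm_sortw _)) perm_cons perm_sym perm_sortw.
  have -> : sort_sign (i :: j :: v) = - ((-1) ^+ (par j && par i) * sort_sign (i ::
    v)) :> A.
    rewrite (sort_sign_alternating [::]) /=; congr (- (_ * _)).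
    rewrite /sort_sign /= (inv_head_le jle); congr (_%:R * _).
    rewrite (even_uniq_cons j); move: okv;
      rewrite even_uniq_cons inE negb_or => /andP [].
    suff -> : j != i by case: (par j) => //= ->.
    by rewrite -val_eqE /= ltn_eqF.
  suff -> : sort_sign (i :: v) * - ((-1) ^+ (par j && par i) * x) =
    - ((-1) ^+ (par j && par i) * sort_sign (i :: v)) * x by apply: ext_eq_refl.
  by rewrite mulrN mulNr mulrA commr_sign.
rewrite -{}ij in sv okv jv *.
(* Equal letters: an odd one may stay, while an even one gives e_i e_i = - e_i e_i, hence zero after
   division by 2. *)
case pi: (par i).
  have s' : sorted leI (i :: i :: v) by rewrite /= /leI leqnn.
  rewrite sortw_id // sort_sign_sorted // even_uniq_cons okv pi mul1r;
    exact: ext_eq_refl.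
have -> : sort_sign (i :: i :: v) = 0 :> A by rewrite /sort_sign even_uniq_cons pi
  inE eqxx mul0r.
rewrite mul0r tword0.
have := @tword_swap a v i i x; rewrite pi /= mul1r => h.
have := ext_idealZ (2%:R^-1)%:A h; congr ideal; apply: funext => w /=.
rewrite /tword mulrN opprK subr0 -mulr2n mulr_algr -scaler_nat scalerA.
by rewrite mulVf ?scale1r // Num.Theory.pnatr_eq0.
Qed.

Lemma tword_sortw w : forall a x, tword (a ++ w) x == tword (a ++ sortw w) (sort_sign
  w * x) %[ext].
Proof.
elim: w => [|i w IH] a x.
  have -> : sort_sign [::] = 1 :> A by rewrite /sort_sign /even_uniq /= mulr1.
  by rewrite mul1r; apply: ext_eq_refl.
have := IH (rcons a i) x; rewrite !cat_rcons => h; apply: ext_eq_trans h _.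
have hp : perm_eq (i :: sortw w) (i :: w) by rewrite perm_cons perm_sortw.
case ok: (even_uniq w); last first.
  have -> : sort_sign w = 0 :> A by rewrite /sort_sign ok mul0r.
  have -> : sort_sign (i :: w) = 0 :> A by rewrite /sort_sign even_uniq_cons ok andbF
    mul0r.
  by rewrite mul0r !tword0; apply: ext_eq_refl.
have ok' : even_uniq (sortw w) by rewrite (even_uniq_perm (perm_sortw w)).
apply: ext_eq_trans (tword_insert (sortw_sorted w) ok' i a _) _.
rewrite (eq_sortw hp) mulrA.
suff -> : sort_sign (i :: sortw w) * sort_sign w = sort_sign (i :: w) :> A by apply:
  ext_eq_refl.
rewrite /sort_sign (even_uniq_perm hp) ok mul1r -mulrA /= -signr_addb.
by rewrite inv_odd_sorted ?sortw_sorted // addbF (inv_head_perm _ (perm_sortw w)).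
Qed.

(* e_w = sum_u e_u (nf_mx u w) in the exterior algebra. *)
Definition nf_mx u w : A := (sortw w == u)%:R * sort_sign w.

Lemma nf_mx_alternating u : alternating (nf_mx u).
Proof.
move=> a b i j; rewrite /nf_mx (eq_sortw (perm_swap2 a b i j)) sort_sign_alternating.
by case: (_ == _); rewrite ?mul0r ?mulr0 ?oppr0 // !mul1r.
Qed.

(** The difference between e_w and its sorted form lies in the ideal, where [h] vanishes; no second
    induction on sorting is made. *)
Lemma alternating_sortw h w : alternating h -> h w = h (sortw w) * sort_sign w.
Proof.
move=> ah; have := alternating_ideal (size w) ah (tword_sortw w [::] 1).
rewrite /= mulr1.
under eq_bigr => v _ do rewrite mulrBr.
rewrite sumrB (@big_tuple_eq _ _ _ (fun v => h v * tword w 1 v) w) //; last first.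
  by move=> v /negPf vw; rewrite /tword vw mul0r mulr0.
rewrite (@big_tuple_eq _ _ _ (fun v => h v * tword (sortw w) (sort_sign w) v) (sortw
  w)) ?size_sortw //.
  by rewrite /tword !eqxx !mul1r mulr1 => /eqP; rewrite subr_eq0 => /eqP.
by move=> v /negPf vw; rewrite /tword vw mul0r mulr0.
Qed.

Definition nf f u := \sum_(w : (size u).-tuple I) nf_mx u w * f w.

Lemma nf_ideal f u : ideal f -> nf f u = 0.
Proof. exact: alternating_ideal (nf_mx_alternating u). Qed.

(** The normal form is an invariant of the class. This yields linear independence in the quotient,
    and [ext_eq_nf] yields spanning. *)
Lemma nf_ext f g u : f == g %[ext] -> nf f u = nf g u.
Proof.
move/(nf_ideal u) => h; apply/eqP; rewrite -subr_eq0 -sumrB; apply/eqP.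
by rewrite -[RHS]h; apply: eq_bigr => w _; rewrite -mulrBr.
Qed.

Lemma tdeg_sum k f : tdeg k f -> f = fun v => \sum_(w : k.-tuple I) tword w (f w) v.
Proof.
move=> hf; apply: funext => v; case: (eqVneq (size v) k) => [sv|sv].
  rewrite (@big_tuple_eq _ _ _ (fun w => tword w (f w) v) v) // /tword ?eqxx ?mul1r //.
  by move=> w /negPf wv; rewrite eq_sym wv mul0r.
rewrite hf // big1 // => w _; rewrite /tword; case: eqP => [vw|_];
  last by rewrite mul0r.
by rewrite vw size_tuple eqxx in sv.
Qed.

Lemma ext_eq_nf k f : tdeg k f ->
  f == (fun v => \sum_(u : k.-tuple I) tword u (nf f u) v) %[ext].
Proof.
move=> hf; rewrite {1}(tdeg_sum hf).
have h : (fun v => \sum_(w : k.-tuple I) tword w (f w) v) ==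
         (fun v => \sum_(w : k.-tuple I) tword (sortw w) (sort_sign w * f w) v) %[ext].
  by apply: ext_eq_sum => w _; apply: (tword_sortw w [::]).
apply: ext_eq_trans h _.
suff -> : (fun v => \sum_(w : k.-tuple I) tword (sortw w) (sort_sign w * f w) v) =
  (fun v => \sum_(u : k.-tuple I) tword u (nf f u) v) by apply: ext_eq_refl.
apply: funext => v; case: (eqVneq (size v) k) => [sv|sv]; last first.
  rewrite !big1 // => w _; rewrite /tword; case: eqP => [vw|_]; rewrite ?mul0r //;
    by rewrite vw ?size_sortw size_tuple eqxx in sv.
rewrite [RHS](@big_tuple_eq _ _ _ (fun u => tword u (nf f u) v) v) //.
  rewrite /tword eqxx mul1r /nf sv; apply: eq_bigr => w _.
  by rewrite /nf_mx eq_sym mulrA.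
by move=> w /negPf wv; rewrite /tword eq_sym wv mul0r.
Qed.

End NormalForm.

(** * Induced operators and their supertraces *)

Section Induced.
Context {K : numFieldType} {A : algType K} (gr : supercommutative A) {p q : nat}.
Local Notation I := 'I_(p + q).
Local Notation word := (seq I).
Local Notation tensor := (@tensor K A p q).
Local Notation ss := (supersign gr).
Local Notation tmul := (tmul gr).
Local Notation par := (@par p q).
Local Notation wpar := (@wpar p q).
Local Notation alternating := (@alternating K A p q).
Local Notation nf_mx := (@nf_mx K A p q).
Implicit Types (i j : I) (a b u v w : word) (f g : tensor) (x y : A).
Implicit Types (M N : 'M[A]_(p + q)).

(* The coefficient of e_u in M e_(w_1) (x) ... (x) M e_(w_k). *)
Fixpoint tmap_mx M u w : A :=
  match u, w with
  | [::], [::] => 1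
  | i :: u', j :: w' => ss (wpar u') (M i j) * tmap_mx M u' w'
  | _, _ => 0
  end.

Lemma tmul_tvec (c : 'cV[A]_(p + q)) g u :
  tmul (tvec c) g u = if u is i :: u' then ss (wpar u') (c i 0) * g u' else 0.
Proof.
case: u => [|i u]; first by rewrite /Defs.tmul big_ord1 /= mul0r.
rewrite /Defs.tmul !big_ord_recl /= supersign0 mul0r add0r /bump /= take0 drop0.
rewrite big1 ?addr0 // => k _; rewrite /= /bump /= add1n.
by case: u k => [[]|j u k] //=; rewrite supersign0 mul0r.
Qed.

Lemma big_tmul_tvec M u w : (\big[tmul/@tone K A p q]_(j <- w) tvec (col j M)) u =
  tmap_mx M u w.
Proof.
elim: w u => [|j w IH] u; first by rewrite big_nil; case: u.
by rewrite big_cons tmul_tvec; case: u => //= i u; rewrite IH mxE.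
Qed.

Lemma tmapE M f u k : size u = k ->
  tmap gr M f u = \sum_(w : k.-tuple I) tmap_mx M u w * f w.
Proof. by move=> <-; rewrite /tmap; apply: eq_bigr => w _; rewrite big_tmul_tvec. Qed.

Lemma tmap_mx_size M u w : size u != size w -> tmap_mx M u w = 0.
Proof.
elim: u w => [|i u IH] [|j w] //=; rewrite eqSS => /IH ->; by rewrite mulr0.
Qed.

Lemma homog_tmap_mx M u w : even_mx gr M -> homog gr (wpar u (+) wpar w) (tmap_mx M u
  w).
Proof.
move=> hM; elim: u w => [|i u IH] [|j w] //=; try exact: homog0; first exact: homog1.
rewrite !wpar_cons addbACA; apply: homogM => //.
exact/homog_supersign/hM.
Qed.

Lemma tmap_mx_cat M u1 u2 w1 w2 : size u1 = size w1 ->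
  tmap_mx M (u1 ++ u2) (w1 ++ w2) = ss (wpar u2) (tmap_mx M u1 w1) * tmap_mx M u2 w2.
Proof.
elim: u1 w1 => [|i u1 IH] [|j w1] //=; first by rewrite (supersign_nat gr _ 1) mul1r.
case=> /IH ->; rewrite supersignM supersign_comp mulrA wpar_cat.
by rewrite addbC.
Qed.

Lemma even_mulmx M N : even_mx gr M -> even_mx gr N -> even_mx gr (M *m N).
Proof.
move=> hM hN i j; rewrite mxE; apply: homog_sum => k _.
by have := homogM (hM i k) (hN k j); rewrite addbA addbK.
Qed.

(** Functoriality T(MN) = T(M) T(N); evenness makes the Koszul signs match. *)
Lemma tmap_mxM M N u w k : even_mx gr M -> even_mx gr N -> size u = k ->
  tmap_mx (M *m N) u w = \sum_(v : k.-tuple I) tmap_mx M u v * tmap_mx N v w.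
Proof.
move=> hM hN; elim: k u w => [|k IH] u w su.
  rewrite (big_tuple0 (fun v => tmap_mx M u v * tmap_mx N v w)).
  by rewrite (size0nil su) /=; case: w => [|j w]; rewrite ?mulr1 ?mul1r.
case: u su => [|i u] //= [su].
rewrite (big_tupleS _ (fun v => tmap_mx M (i :: u) v * tmap_mx N v w)).
case: w => [|j w] /=.
  by rewrite big1 // => l _; rewrite big1 // => v _; rewrite mulr0.
rewrite IH // mxE supersign_sum mulr_suml; apply: eq_bigr => l _.
rewrite mulr_sumr; apply: eq_bigr => v _.
rewrite supersignM -!mulrA; congr (_ * _).
(* Moving [N l j] across [tmap_mx M u v], of parity [wpar u (+) wpar v], turns the sign for [v] into
   the sign for [u]. *)
rewrite (mulrA (tmap_mx M u v)) (mulC_supersign (ss _ _) (homog_tmap_mx u v hM))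
  supersign_comp -addbA addbb addbF.
by rewrite -mulrA.
Qed.

Lemma tmap_mx_diag M u w : even_mx gr M -> is_diag_mx M ->
  tmap_mx M u w = (u == w)%:R * \prod_(i <- u) M i i.
Proof.
move=> hM /is_diag_mxP dM.
elim: u w => [|i u IH] [|j w] //=; rewrite ?mul0r ?big_nil ?mulr1 //.
rewrite IH eqseq_cons big_cons; case: (eqVneq i j) => [<-|ij] /=.
  rewrite (supersign_homog _ (hM i i)) addbb andbF mul1r.
  by case: (u == w); rewrite ?mul1r // !mul0r mulr0.
by rewrite dM ?supersign0 ?mul0r // val_eqE.
Qed.

(** T(M) commutes with the signed exchange of adjacent tensor factors, because M is even. *)
Lemma tmap_mx_swap M a b c d k l i j : even_mx gr M -> size a = size c ->
  tmap_mx M (a ++ l :: k :: b) (c ++ j :: i :: d) =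
  (-1) ^+ ((par k && par l) (+) (par i && par j)) *
    tmap_mx M (a ++ k :: l :: b) (c ++ i :: j :: d).
Proof.
move=> hM sac; rewrite !tmap_mx_cat //=.
have -> : wpar [:: l, k & b] = wpar [:: k, l & b] by rewrite !wpar_cons addbCA.
set E := ss _ (tmap_mx M a c); set F := tmap_mx M b d.
rewrite !wpar_cons !(supersign_homog _ (hM _ _)).
set s1 := (-1) ^+ _; set s2 := (-1) ^+ _; set s3 := (-1) ^+ _.
set s4 := (-1) ^+ _; set s5 := (-1) ^+ _.
(* The same two entries in opposite orders; the signs agree for all parities of the four letters and
   of the rest of the word. *)
have key : s1 * M l j * (s2 * M k i) = s3 * (s4 * M k i * (s5 * M l j)).
  have := supercomm (hM l j) (hM k i).
  rewrite /s1 /s2 /s3 /s4 /s5 !mulr_sign {E F s1 s2 s3 s4 s5}.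
  case: (par k) (par l) (par i) (par j) (wpar b) => [] [] [] [] [] /= e;
  by rewrite ?mulNr ?mulrN ?opprK e ?opprK.
by rewrite (mulrA (s1 * _)) key -!mulrA (mulrA E s3) /s3 (commr_sign E) -mulrA.
Qed.

Lemma big_tuple_cat2 (m n : nat) (F : word -> A) :
  \sum_(v : (m + n.+2).-tuple I) F v =
  \sum_(a : m.-tuple I) \sum_i \sum_j \sum_(b : n.-tuple I) F (a ++ i :: j :: b).
Proof.
rewrite big_tuple_cat; apply: eq_bigr => a _.
rewrite (big_tupleS _ (fun v => F (a ++ v))); apply: eq_bigr => i _.
by rewrite (big_tupleS _ (fun v => F (a ++ i :: v))).
Qed.

(** The operator induced by M, applied to a word and then projected to sorted words. *)
Definition ext_mx M k u w := \sum_(v : k.-tuple I) nf_mx u v * tmap_mx M v w.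

(** This expresses that T(M) preserves the ideal: exchanging the matching letters of [v] produces a
    sign in each factor, and the parts that depend on [v] cancel. *)
Lemma ext_mx_alternating M k u : even_mx gr M -> alternating (ext_mx M k u).
Proof.
move=> hM c d i j; rewrite /ext_mx.
case: (eqVneq k (size c + (size d).+2)%N) => [->|hk]; last first.
  rewrite !big1 ?mulr0 ?oppr0 // => v _; rewrite tmap_mx_size ?mulr0 //;
  by rewrite size_tuple size_cat /=.
rewrite (big_tuple_cat2 _ _ (fun v => nf_mx u v * tmap_mx M v (c ++ j :: i :: d))).
rewrite (big_tuple_cat2 _ _ (fun v => nf_mx u v * tmap_mx M v (c ++ i :: j :: d))).
rewrite mulr_sumr -sumrN; apply: eq_bigr => a _.
(* Exchanging the sums over the two middle letters matches each [v] with its swapped word. *)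
rewrite exchange_big mulr_sumr -sumrN; apply: eq_bigr => x _.
rewrite mulr_sumr -sumrN; apply: eq_bigr => y _.
rewrite mulr_sumr -sumrN; apply: eq_bigr => b _.
rewrite nf_mx_alternating tmap_mx_swap ?size_tuple // !mulr_sign.
case: (par x && par y) (par i && par j) => [] [] /=;
by rewrite ?mulNr ?mulrN ?mulNr ?opprK.
Qed.

Lemma homog_sort_sign w : homog gr false (sort_sign w).
Proof.
rewrite /sort_sign;
  have := homogM (homog_nat gr (even_uniq w)) (homog_sign (inv_odd w) (homog1 gr)).
by rewrite mulr1.
Qed.

Lemma homog_nf_mx u w : homog gr (wpar u (+) wpar w) (nf_mx u w).
Proof.
rewrite /nf_mx; case: eqP => [<-|_]; last by rewrite mul0r; apply: homog0.
by rewrite mul1r (wpar_perm (perm_sortw w)) addbb; apply: homog_sort_sign.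
Qed.

Lemma homog_ext_mx M k u w : even_mx gr M -> homog gr (wpar u (+) wpar w) (ext_mx M k
  u w).
Proof.
move=> hM; apply: homog_sum => v _.
by have := homogM (homog_nf_mx u v) (homog_tmap_mx v w hM); rewrite addbA addbK.
Qed.

(** Column [w] of [nf_mx] is supported at [sortw w], so this is [alternating_sortw] in matrix form.
    It allows the projection to be inserted or absorbed on the right. *)
Lemma alternating_nf_mx (h : word -> A) w k : alternating h -> size w = k ->
  \sum_(v : k.-tuple I) h v * nf_mx v w = h w.
Proof.
move=> ah sw_k;
  rewrite (@big_tuple_eq _ _ _ (fun v => h v * nf_mx v w) (sortw w)) ?size_sortw //.
  by rewrite /nf_mx eqxx mul1r -(alternating_sortw gr).
by move=> v /negPf vw; rewrite /nf_mx eq_sym vw mul0r mulr0.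
Qed.

(* The supertrace on the k-th exterior power: as [nf_mx] projects words onto sorted
   words, one may sum over all words instead of a basis. *)
Definition ext_str k M : A :=
  \sum_(u : k.-tuple I) (-1) ^+ wpar u * \sum_(w : k.-tuple I) nf_mx u w * tmap_mx M
    w u.

(** With Pi for [nf_mx], alternation gives Pi T(P) = Pi T(P) Pi. A copy of Pi is inserted between
    T(P) and T(MQ), the supertrace is rotated, and the extra copy is absorbed again. *)
Lemma ext_str_conj k M P Q : even_mx gr M -> even_mx gr P -> even_mx gr Q ->
  Q *m P = 1%:M -> ext_str k (P *m M *m Q) = ext_str k M.
Proof.
move=> hM hP hQ QP; rewrite /ext_str -mulmxA.
have hMQ := even_mulmx hM hQ.
pose X u w := ext_mx P k u w; pose Z v u := ext_mx (M *m Q) k v u.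
transitivity (\sum_(u : k.-tuple I) (-1) ^+ wpar u *
    \sum_(v : k.-tuple I) X u v * Z v u).
  apply: eq_bigr => u _; congr (_ * _).
  transitivity (\sum_(v : k.-tuple I) X u v * tmap_mx (M *m Q) v u).
    under eq_bigr => w _ do rewrite (tmap_mxM _ hP hMQ (size_tuple w)) mulr_sumr.
    rewrite exchange_big /=; apply: eq_bigr => v _.
    by rewrite mulr_suml; apply: eq_bigr => w _; rewrite mulrA.
  under eq_bigr => v _ do
    rewrite -[X u v](alternating_nf_mx (ext_mx_alternating k u hP) (size_tuple v))
      mulr_suml.
  rewrite exchange_big /=; apply: eq_bigr => v _.
  by rewrite mulr_sumr; apply: eq_bigr => w _; rewrite mulrA.
rewrite (@str_cyclic _ _ gr _ _ (fun u : k.-tuple I => wpar u)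
  (fun v : k.-tuple I => wpar v) X Z) => [|u v|v u]; try exact: homog_ext_mx.
apply: eq_bigr => v _; congr (_ * _).
have hMQP := even_mulmx hMQ hP.
transitivity (\sum_(w : k.-tuple I) nf_mx v w * tmap_mx (M *m Q *m P) w v); last first.
  by rewrite -mulmxA QP mulmx1.
under [RHS]eq_bigr => w _ do rewrite (tmap_mxM _ hMQ hP (size_tuple w)) mulr_sumr.
rewrite exchange_big /=.
transitivity (\sum_(t : k.-tuple I) Z v t * tmap_mx P t v).
  rewrite /X /Z; under eq_bigr => u _ do rewrite mulr_sumr.
  rewrite exchange_big /=; apply: eq_bigr => t _.
  under eq_bigr => u _ do rewrite mulrA.
  by rewrite -mulr_suml (alternating_nf_mx (ext_mx_alternating k v hMQ) (size_tuple t)).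
by apply: eq_bigr => t _; rewrite mulr_suml; apply: eq_bigr => w _; rewrite mulrA.
Qed.

End Induced.

(** * Independence of the supertrace from the basis *)

Section TraceInvariance.
Context {K : numFieldType} {A : algType K} (gr : supercommutative A) {p q : nat}.
Local Notation I := 'I_(p + q).
Local Notation word := (seq I).
Local Notation tensor := (@tensor K A p q).
Local Notation wpar := (@wpar p q).
Local Notation nf_mx := (@nf_mx K A p q).
Local Notation nf := (@nf K A p q).
Local Notation ext_mx := (ext_mx gr).
Local Notation "f == g '%[ext]'" := (ext_eq gr f g) (at level 70, g at next level).
Implicit Types (u v w : word) (f g : tensor) (M : 'M[A]_(p + q)).

Lemma supertraceE r s (N : 'M[A]_(r + s)) :
  supertrace N = \sum_i (-1) ^+ par i * N i i.
Proof.
rewrite /supertrace /mxtrace big_split_ord /= -sumrN; congr (_ + _).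
  by apply: eq_bigr => i _; rewrite !mxE /par /= leqNgt ltn_ord mul1r.
by apply: eq_bigr => i _; rewrite !mxE /par /= leq_addr mulN1r.
Qed.

Lemma nf_tcomb m (b : 'I_m -> tensor) x u :
  nf (tcomb b x) u = \sum_i nf (b i) u * x i.
Proof.
rewrite /nf /tcomb; under eq_bigr do rewrite mulr_sumr.
rewrite exchange_big /=; apply: eq_bigr => i _; rewrite mulr_suml.
by apply: eq_bigr => w _; rewrite mulrA.
Qed.

Lemma nf_tword u w x : size u = size w -> nf (tword w x) u = nf_mx u w * x.
Proof.
move=> uw; rewrite /nf (@big_tuple_eq _ _ _ (fun v => nf_mx u v * tword w x v) w) //.
  by rewrite /tword eqxx mul1r.
by move=> v /negPf vw; rewrite /tword vw mul0r mulr0.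
Qed.

Lemma nfE f u k : size u = k -> nf f u = \sum_(w : k.-tuple I) nf_mx u w * f w.
Proof. by move=> <-. Qed.

Lemma nf_tmap M f u k : even_mx gr M -> size u = k ->
  nf (tmap gr M f) u = \sum_(t : k.-tuple I) ext_mx M k u t * nf f t.
Proof.
move=> hM su; rewrite (nfE _ su).
under eq_bigr => v _ do rewrite (tmapE _ _ _ (size_tuple v)) mulr_sumr.
rewrite exchange_big /=.
transitivity (\sum_(w : k.-tuple I) ext_mx M k u w * f w).
  by apply: eq_bigr => w _; rewrite mulr_suml; apply: eq_bigr => v _; rewrite mulrA.
under [LHS]eq_bigr => w _ do
  rewrite -(alternating_nf_mx gr (ext_mx_alternating k u hM) (size_tuple w)) mulr_suml.
rewrite [LHS]exchange_big /=; apply: eq_bigr => t _;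
  rewrite (nfE f (size_tuple t)) mulr_sumr.
by apply: eq_bigr => w _; rewrite mulrA.
Qed.

Lemma ext_strE k M : ext_str gr k M = \sum_(u : k.-tuple I) (-1) ^+ wpar u * ext_mx M
  k u u.
Proof. by []. Qed.

Lemma tcomb_inj k r s (b : 'I_(r + s) -> tensor) x y :
  ext_basis gr k b -> tcomb b x == tcomb b y %[ext] -> x =1 y.
Proof.
case=> _ _ indep _ h i; apply/eqP; rewrite -subr_eq0; apply/eqP.
apply: (indep (fun i => x i - y i)); move: h; congr ext_ideal.
apply: funext => w /=; rewrite /tcomb subr0 -sumrB.
by apply: eq_bigr => j _; rewrite mulrBr.
Qed.

(** For E = [ext_mx M k] and the base changes C and D, one has N = D E C, and cyclicity turns str N
    into str(E C D) = str(E [nf_mx]) = str E. *)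
Lemma is_ext_traceE M k t : even_mx gr M -> is_ext_trace gr M k t -> t = ext_str gr k M.
Proof.
move=> hM [r [s [b [N [hb hN ->]]]]].
have [bk bh _ span] := hb.
(* C and D are the base changes between the basis b and the words:
   C D = nf_mx and D C = 1. *)
pose C u j := nf (b j) u.
have [D hD] : {D : k.-tuple I -> 'I_(r + s) -> A &
    forall u : k.-tuple I, tword u 1 == tcomb b (D u) %[ext]}.
  apply: (@choice _ _ (fun (u : k.-tuple I) x => tword (tval u) 1 == tcomb b x
    %[ext])) => u.
  by apply: span => w wk; move: wk; rewrite /tword; case: (w =P tval u) => [->|_ _];
    rewrite ?size_tuple ?eqxx ?mul0r.
have hC (u : k.-tuple I) j : homog gr (wpar u (+) par j) (C u j).
  apply: homog_sum => w _; have := homogM (homog_nf_mx gr u w) (bh j w).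
  by rewrite (addbC (par j)) addbA addbK.
have CD (u w : k.-tuple I) : \sum_j C u j * D w j = nf_mx u w.
  by rewrite -nf_tcomb -(nf_ext _ (hD w)) nf_tword ?mulr1 // !size_tuple.
have DC j j' : \sum_(u : k.-tuple I) D u j * C u j' = (j == j')%:R.
  apply: (tcomb_inj hb (x := fun j => \sum_(u : k.-tuple I) D u j * C u j')
    (y := fun j => (j == j')%:R)).
  have -> : tcomb b (fun j => (j == j')%:R) = b j'.
    apply: funext => w; rewrite /tcomb (bigD1 j') //= eqxx mulr1 big1 ?addr0 //.
    by move=> i /negPf ->; rewrite mulr0.
  apply: ext_eq_sym; apply: (ext_eq_trans (ext_eq_nf gr (bk j'))).
  have -> : tcomb b (fun j => \sum_(u : k.-tuple I) D u j * C u j') =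
      (fun w => \sum_(u : k.-tuple I) tcomb b (D u) w * C u j').
    apply: funext => w; rewrite /tcomb; under eq_bigr do rewrite mulr_sumr.
    rewrite exchange_big /=; apply: eq_bigr => u _; rewrite mulr_suml.
    by apply: eq_bigr => i _; rewrite mulrA.
  apply: ext_eq_sum => u _.
  have -> : tword u (nf (b j') u) = fun w => tword u 1 w * C u j'.
    by apply: funext => w; rewrite /tword mulr1.
  exact: ext_eqZ.
(* Cyclicity needs D to be even, which its choice does not provide. The part of D of the right
   parity also solves C D = [nf_mx], and D C = 1 makes the solution unique. *)
have hD' (u : k.-tuple I) j : homog gr (par j (+) wpar u) (D u j).
  pose De (w : k.-tuple I) j := part gr (par j (+) wpar w) (D w j).
  suff <- : De u j = D u j by apply: homog_part.
  have CDe (v w : k.-tuple I) : \sum_j C v j * De w j = nf_mx v w.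
    rewrite -[RHS](part_homog (homog_nf_mx gr v w)) -CD part_sum.
    apply: eq_bigr => i _; rewrite (part_mull _ _ (hC v i)).
    by rewrite [in RHS]addbACA addbb.
  have LDe (E : k.-tuple I -> 'I_(r + s) -> A) :
      (forall v w : k.-tuple I, \sum_j C v j * E w j = nf_mx v w) ->
      E u j = \sum_(v : k.-tuple I) D v j * nf_mx v u.
    move=> hE; under [RHS]eq_bigr => v _ do rewrite -hE mulr_sumr.
    rewrite exchange_big /=.
    under [RHS]eq_bigr => i _ do under eq_bigr => v _ do rewrite mulrA.
    under [RHS]eq_bigr => i _ do rewrite -mulr_suml DC.
    rewrite (bigD1 j) //= eqxx mul1r big1 ?addr0 // => i /negPf ij.
    by rewrite eq_sym ij mul0r.
  by rewrite (LDe De CDe) (LDe D CD).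
have CN (u : k.-tuple I) j :
    \sum_(t : k.-tuple I) ext_mx M k u t * C t j = \sum_i C u i * N i j.
  by rewrite -(nf_tmap (b j) hM (size_tuple u)) (nf_ext _ (hN j)) nf_tcomb.
pose Y (u : k.-tuple I) j := \sum_(t : k.-tuple I) ext_mx M k u t * C t j.
have NE i j : N i j = \sum_(u : k.-tuple I) D u i * Y u j.
  rewrite /Y; under [RHS]eq_bigr => u _ do rewrite CN mulr_sumr.
  rewrite exchange_big /=.
  under [RHS]eq_bigr => l _ do under eq_bigr => v _ do rewrite mulrA.
  under [RHS]eq_bigr => l _ do rewrite -mulr_suml DC.
  rewrite (bigD1 i) //= eqxx mul1r big1 ?addr0 // => l /negPf il.
  by rewrite eq_sym il mul0r.
rewrite supertraceE; under eq_bigr => i _ do rewrite NE.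
rewrite (@str_cyclic _ _ gr _ _ (@par r s) (fun u : k.-tuple I => wpar u)
  (fun i (u : k.-tuple I) => D u i) Y) //; last first.
  move=> u j; apply: homog_sum => v _.
  by have := homogM (homog_ext_mx k u v hM) (hC v j); rewrite addbA addbK.
rewrite ext_strE; apply: eq_bigr => u _; congr (_ * _).
rewrite -(alternating_nf_mx gr (ext_mx_alternating k u hM) (size_tuple u)).
rewrite /Y; under eq_bigr do rewrite mulr_suml.
rewrite exchange_big /=; apply: eq_bigr => v _.
by rewrite -CD mulr_sumr; apply: eq_bigr => i _; rewrite mulrA.
Qed.

(** Labels of the standard basis: wedge monomials in the even letters times ordinary monomials in
    the odd ones. *)
Definition canon w := sorted leI w && even_uniq w.

Lemma nf_mx_canon u w : canon w -> nf_mx u w = (w == u)%:R.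
Proof. by case/andP=> sw_w ok;
  rewrite /nf_mx sortw_id // sort_sign_sorted // ok mulr1. Qed.

Lemma nf_canon f u : ~~ canon u -> nf f u = 0.
Proof.
move=> cu; apply: big1 => w _; rewrite /nf_mx; case: eqP => [wu|_];
  last by rewrite !mul0r.
rewrite /sort_sign; case ok: (even_uniq w); last by rewrite !(mul0r, mulr0).
by case/negP: cu; rewrite /canon -wu sortw_sorted (even_uniq_perm (perm_sortw w)) ok.
Qed.

Definition canon_words k e :=
  [seq tval u | u : k.-tuple I <- enum {: k.-tuple I} & canon u && (wpar u == e)].

Lemma mem_canon_words k e w :
  (w \in canon_words k e) = [&& size w == k, canon w & wpar w == e].
Proof.
apply/mapP/and3P => [[u]|[/eqP sw_k cw ew]].
  by rewrite mem_filter => /andP [/andP [cu eu] _] ->; rewrite size_tuple.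
subst k; exists (in_tuple w) => //.
by rewrite mem_filter /= cw ew mem_enum.
Qed.

Lemma canon_words_uniq k : uniq (canon_words k false ++ canon_words k true).
Proof.
have u1 e : uniq (canon_words k e).
  rewrite map_inj_uniq => [|u v /val_inj //].
  by apply: filter_uniq; exact: enum_uniq.
rewrite cat_uniq !u1 andbT /=; apply/hasPn => w; rewrite !mem_canon_words.
by case/and3P=> _ _ /eqP ->; rewrite /= !andbF.
Qed.

(** Normal forms vanish off canonical words, which gives spanning; on canonical words [nf_mx] is a
    Kronecker delta, which gives independence. *)
Lemma ext_basis_exists k : exists r s (b : 'I_(r + s) -> tensor), ext_basis gr k b.
Proof.
pose r := size (canon_words k false); pose s := size (canon_words k true).
pose W := canon_words k false ++ canon_words k true.
have sW : size W = (r + s)%N by rewrite size_cat.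
pose wd (i : 'I_(r + s)) := nth [::] W i.
have wdW i : wd i \in W by rewrite mem_nth // sW.
have memW w : (w \in W) = (size w == k) && canon w.
  by rewrite mem_cat !mem_canon_words;
    case: (size w == k) (canon w) (wpar w) => [] [] [].
have wdk i : size (wd i) = k by have := wdW i; rewrite memW => /andP [/eqP].
have wdc i : canon (wd i) by have := wdW i; rewrite memW => /andP [].
have wdp i : wpar (wd i) = par i.
  rewrite /wd /W nth_cat /par; case: ltnP => hi.
    by have := mem_nth [::] hi; rewrite mem_canon_words => /and3P [_ _ /eqP].
  have hi' : (i - size (canon_words k false) < size (canon_words k true))%N.
    by rewrite ltn_subLR.
  by have := mem_nth [::] hi'; rewrite mem_canon_words => /and3P [_ _ /eqP].
have wd_inj : injective wd.
  move=> i j /eqP; rewrite nth_uniq ?sW ?canon_words_uniq // => /eqP ij.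
  exact: val_inj.
exists r, s, (fun i => tword (wd i) 1); split.
- by move=> i w; rewrite /tword; case: (w =P wd i) => [->|_ _];
  rewrite ?wdk ?eqxx ?mul0r.
- move=> i w; rewrite /tword mulr1; case: eqP => [->|_]; last exact: homog0.
  by rewrite wdp addbb; apply: homog1.
- move=> x /(nf_ext) h i; have := h (wd i); rewrite nf_tcomb.
  rewrite (bigD1 i) //= nf_tword // nf_mx_canon // eqxx !mul1r big1 ?addr0.
    by move=> ->; apply: big1 => w _; rewrite mulr0.
  move=> j /negPf ji; rewrite nf_tword ?wdk // nf_mx_canon // (inj_eq wd_inj) ji.
  by rewrite !mul0r.
move=> f fk; exists (fun i => nf f (wd i)); apply: (ext_eq_trans (ext_eq_nf gr fk)).
set F := (X in ext_eq _ X _); set G := (X in ext_eq _ _ X).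
suff -> : F = G by apply: ext_eq_refl.
apply: funext => v; rewrite /F /G /tcomb.
transitivity (if v \in W then nf f v else 0); last first.
  case: ifP => vW.
    have hi : (index v W < r + s)%N by rewrite -sW index_mem.
    have vE : wd (Ordinal hi) = v by rewrite /wd /= nth_index.
    rewrite (bigD1 (Ordinal hi)) //= {1}vE /tword eqxx !mul1r vE big1 ?addr0 // => j ji.
    by rewrite -vE (inj_eq wd_inj) eq_sym (negPf ji) !mul0r.
  by rewrite big1 // => j _; move: vW; rewrite /tword; case: (v =P wd j) => [->|_ _];
    rewrite ?wdW // !mul0r.
rewrite memW; case: (eqVneq (size v) k) => [vk|vk] /=.
  rewrite (@big_tuple_eq _ _ _ (fun u => tword u (nf f u) v) v) //.
    by rewrite /tword eqxx mul1r; case: ifPn => // /nf_canon.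
  by move=> u /negPf uv; rewrite /tword eq_sym uv mul0r.
rewrite big1 // => u _; rewrite /tword; case: eqP => [vu|_]; last by rewrite mul0r.
by rewrite vu size_tuple eqxx in vk.
Qed.

Lemma ext_trace_nat M (k : nat) : even_mx gr M -> ext_trace gr M k = ext_str gr k M.
Proof.
move=> hM; apply: is_ext_traceE => //; apply: xgetPex.
have [r [s [b hb]]] := ext_basis_exists k; have [bk _ _ span] := hb.
have hT j : tdeg k (tmap gr M (b j)).
  move=> u uk; rewrite (tmapE gr M (b j) (erefl (size u))); apply: big1 => w _.
  by rewrite bk ?mulr0 // size_tuple.
have [N hN] : {N : 'I_(r + s) -> 'I_(r + s) -> A &
    forall j, tmap gr M (b j) == tcomb b (N j) %[ext]}.
  by apply: (@choice _ _ (fun j x => tmap gr M (b j) == tcomb b x %[ext])) => j;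
    apply: span.
exists (supertrace (\matrix_(i, j) N j i)), r, s, b, (\matrix_(i, j) N j i);
  split=> // j.
apply: (ext_eq_trans (hN j)).
suff -> : tcomb b (N j) = tcomb b (fun i => (\matrix_(i, j) N j i) i j) by apply:
  ext_eq_refl.
by apply: funext => w; apply: eq_bigr => i _; rewrite mxE.
Qed.

End TraceInvariance.

(** * Formal power series over a superalgebra *)

Definition fps (R : Type) := nat -> R.

Section FpsRing.
Variable R : nzRingType.
Local Notation fps := (fps R).
Implicit Types f g h : fps.

HB.instance Definition _ := Choice.copy fps (nat -> R).

Definition fps_add f g : fps := fun n => f n + g n.
Definition fps_opp f : fps := fun n => - f n.
Definition fps_zero : fps := fun=> 0.

Fact fps_addA : associative fps_add.
Proof. by move=> f g h; apply: funext => n; apply: addrA. Qed.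
Fact fps_addC : commutative fps_add.
Proof. by move=> f g; apply: funext => n; apply: addrC. Qed.
Fact fps_add0 : left_id fps_zero fps_add.
Proof. by move=> f; apply: funext => n; apply: add0r. Qed.
Fact fps_addN : left_inverse fps_zero fps_opp fps_add.
Proof. by move=> f; apply: funext => n; apply: addNr. Qed.

HB.instance Definition _ :=
  GRing.isZmodule.Build fps fps_addA fps_addC fps_add0 fps_addN.

Definition fps_one : fps := fun n => (n == 0%N)%:R.
Definition fps_mul f g : fps := fun n => \sum_(i < n.+1) f i * g (n - i)%N.

Let trunc n f : {poly R} := \poly_(i < n) f i.

(** Coefficient n depends only on truncations, so associativity is inherited from polynomials. *)
Lemma fps_mulE N f g n : (n < N)%N -> fps_mul f g n = (trunc N f * trunc N g)`_n.
Proof.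
move=> nN; rewrite coefM; apply: eq_bigr => i _; rewrite !coef_poly.
rewrite (leq_ltn_trans (leq_subr _ _) nN) (leq_ltn_trans _ nN) //.
by rewrite -ltnS.
Qed.

Fact fps_mulA : associative fps_mul.
Proof.
move=> f g h; apply: funext => n.
have nn (i : 'I_n.+1) : (i < n.+1)%N /\ (n - i < n.+1)%N.
  by split=> //; rewrite ltnS leq_subr.
have tE f' (i : nat) : (i < n.+1)%N -> f' i = (trunc n.+1 f')`_i.
  by move=> hi; rewrite coef_poly hi.
transitivity (trunc n.+1 f * (trunc n.+1 g * trunc n.+1 h))`_n.
  rewrite coefM; apply: eq_bigr => i _; have [h1 h2] := nn i.
  by rewrite (tE f) // (@fps_mulE n.+1).
rewrite mulrA coefM; apply: eq_bigr => i _; have [h1 h2] := nn i.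
by rewrite (@fps_mulE n.+1) // (tE h).
Qed.
Fact fps_mul1f : left_id fps_one fps_mul.
Proof.
move=> f; apply: funext => n; rewrite /fps_mul big_ord_recl mul1r subn0 big1 ?addr0 //.
by move=> i _; rewrite /fps_one mul0r.
Qed.
Fact fps_mulf1 : right_id fps_one fps_mul.
Proof.
move=> f; apply: funext => n;
  rewrite /fps_mul big_ord_recr /= subnn mulr1 big1 ?add0r //.
by move=> i _; rewrite /fps_one subn_eq0 leqNgt ltn_ord mulr0.
Qed.
Fact fps_mulDl : left_distributive fps_mul +%R.
Proof.
move=> f g h; apply: funext => n; rewrite /fps_mul -[RHS]big_split /=.
by apply: eq_bigr => i _; apply: mulrDl.
Qed.
Fact fps_mulDr : right_distributive fps_mul +%R.
Proof.
move=> f g h; apply: funext => n; rewrite /fps_mul -[RHS]big_split /=.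
by apply: eq_bigr => i _; apply: mulrDr.
Qed.
Fact fps_1neq0 : fps_one != 0.
Proof. by apply/eqP => /(congr1 (fun f => f 0%N)) /eqP; rewrite oner_eq0. Qed.

HB.instance Definition _ := GRing.Zmodule_isNzRing.Build fps
  fps_mulA fps_mul1f fps_mulf1 fps_mulDl fps_mulDr fps_1neq0.

Lemma fps_coefD f g n : (f + g) n = f n + g n. Proof. by []. Qed.
Lemma fps_coefN f n : (- f) n = - f n. Proof. by []. Qed.
Lemma fps_coefM f g n : (f * g) n = \sum_(i < n.+1) f i * g (n - i)%N.
Proof. by []. Qed.
Lemma fps_coef_sum (I : Type) (r : seq I) (P : pred I) (F : I -> fps) n :
  (\sum_(i <- r | P i) F i) n = \sum_(i <- r | P i) F i n.
Proof. by rewrite (big_morph (fun f : fps => f n) (id1 := 0) (op1 := +%R)). Qed.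

End FpsRing.

Lemma fps_mulC (R : comNzRingType) : commutative (@fps_mul R).
Proof.
move=> f g; apply: funext => n; rewrite /fps_mul (reindex_inj rev_ord_inj) /=.
by apply: eq_bigr => i _; rewrite subSS subKn 1?mulrC // -ltnS.
Qed.
HB.instance Definition _ (R : comNzRingType) :=
  GRing.PzRing_hasCommutativeMul.Build (fps R) (@fps_mulC R).

Section FpsAlg.
Context {K : nzRingType} {A : algType K}.
Implicit Types (f g : fps A) (a b : K).

Definition fps_scale a f : fps A := fun n => a *: f n.

Fact fps_scaleA a b f : fps_scale a (fps_scale b f) = fps_scale (a * b) f.
Proof. by apply: funext => n; apply: scalerA. Qed.
Fact fps_scale1 : left_id 1 fps_scale.
Proof. by move=> f; apply: funext => n; apply: scale1r. Qed.
Fact fps_scaleDr : right_distributive fps_scale +%R.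
Proof. by move=> a f g; apply: funext => n; apply: scalerDr. Qed.
Fact fps_scaleDl f : {morph fps_scale^~ f : a b / a + b}.
Proof. by move=> a b; apply: funext => n; apply: scalerDl. Qed.

HB.instance Definition _ := GRing.Zmodule_isLmodule.Build K (fps A)
  fps_scaleA fps_scale1 fps_scaleDr fps_scaleDl.

Lemma fps_coefZ a f n : (a *: f) n = a *: f n. Proof. by []. Qed.

Fact fps_scaleAl a f g : a *: (f * g) = (a *: f) * g.
Proof.
apply: funext => n; rewrite fps_coefZ !fps_coefM scaler_sumr.
by apply: eq_bigr => i _; apply: scalerAl.
Qed.
HB.instance Definition _ := GRing.Lmodule_isLalgebra.Build K (fps A) fps_scaleAl.

Fact fps_scaleAr a f g : a *: (f * g) = f * (a *: g).
Proof.
apply: funext => n; rewrite fps_coefZ !fps_coefM scaler_sumr.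
by apply: eq_bigr => i _; apply: scalerAr.
Qed.
HB.instance Definition _ := GRing.Lalgebra_isAlgebra.Build K (fps A) fps_scaleAr.

Variable gr : supercommutative A.

Definition fps_homog e f := forall n, homog gr e (f n).
Definition fps_part e f : fps A := fun n => part gr e (f n).

(** The variable s is even, so the grading is coefficientwise. The definition is transparent so that
    [part] computes in [fps_supersign]. *)
Definition fps_super : supercommutative (fps A).
Proof.
apply: (@Supercommutative K (fps A) fps_homog fps_part).
- by move=> e n; apply: homog0.
- by move=> e a f g hf hg n; apply: homogP.
- by move=> n; apply: homog_nat.
- move=> e e' f g hf hg n; rewrite fps_coefM; apply: homog_sum => i _.
  exact: homogM.
- by move=> e f n; apply: homog_part.
- by move=> f; apply: funext => n; apply: partD.
- by move=> f h0 h1; apply: funext => n; apply: (homog_direct (h0 n) (h1 n)).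
move=> e e' f g hf hg; apply: funext => n.
have -> : ((-1) ^+ (e && e') * (g * f)) n = (-1) ^+ (e && e') * (g * f) n.
  by rewrite !mulr_sign; case: (_ && _).
rewrite !fps_coefM mulr_sumr (reindex_inj rev_ord_inj) /=.
apply: eq_bigr => i _; rewrite subSS subKn; last by rewrite -ltnS.
exact: (supercomm (hf _) (hg _)).
Defined.

Lemma fps_supersign d f n : supersign fps_super d f n = supersign gr d (f n).
Proof. by rewrite /supersign; case: d. Qed.

End FpsAlg.

(** Course-of-values recursion: [F] receives the list of all earlier values. *)
Lemma strong_rec (T : Type) (F : seq T -> T) :
  exists g : nat -> T, forall n, g n = F (mkseq g n).
Proof.
pose h n := iter n (fun s => rcons s (F s)) [::]; exists (fun n => F (h n)) => n.
congr F; elim: n => //= n IH; rewrite -[n.+1]addn1 /mkseq iotaD map_cat /= add0n -cats1.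
by rewrite {1}IH.
Qed.

(** * Diagonalization over power series *)

Section Diagonalization.
Context {K : numFieldType} {A : algType K} (gr : supercommutative A) {p q : nat}.
Local Notation I := 'I_(p + q).
Local Notation mx := 'M[A]_(p + q).
Local Notation fmx := 'M[fps A]_(p + q).
Local Notation grf := (fps_super gr).
Implicit Types (i j : I) (P Q : nat -> mx) (M : mx).

Definition mx_of_seq P : fmx := \matrix_(i, j) ((fun m => P m i j) : fps A).

Lemma mx_of_seqM P Q :
  mx_of_seq P *m mx_of_seq Q = mx_of_seq (fun m => \sum_(l < m.+1) P l *m Q (m - l)%N).
Proof.
apply/matrixP => i j; rewrite !mxE; apply: funext => m.
rewrite fps_coef_sum summxE; under eq_bigr => k _ do rewrite !mxE fps_coefM.
by rewrite exchange_big /=; apply: eq_bigr => l _; rewrite mxE.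
Qed.

Definition one_seq : nat -> mx := fun m => if m is 0 then 1%:M else 0.

Lemma mx_of_seq1 : mx_of_seq one_seq = 1%:M.
Proof.
apply/matrixP => i j; rewrite !mxE; apply: funext => [[|m]] /=.
  by rewrite mxE; case: (i == j).
by rewrite mxE; case: (i == j).
Qed.

Definition even_seq P := forall m, even_mx gr (P m).

Lemma even_mx_of_seq P : even_seq P -> even_mx grf (mx_of_seq P).
Proof. by move=> hP i j m; rewrite mxE; apply: hP. Qed.

Lemma even_mx1 : even_mx (r := p) (s := q) gr 1%:M.
Proof.
by move=> i j; rewrite mxE; case: eqP => [->|_]; rewrite ?addbb;
  [apply: homog1|apply: homog0].
Qed.

(** With constant term 1, each coefficient of an inverse is determined by the earlier ones. A right
    and a left inverse are built separately and then coincide. *)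
Lemma mx_of_seq_inv P : P 0%N = 1%:M -> even_seq P ->
  exists Q : fmx, [/\ even_mx grf Q, mx_of_seq P *m Q = 1%:M & Q *m mx_of_seq P = 1%:M].
Proof.
move=> P0 eP.
have [H hH] := strong_rec (fun s : seq mx => if size s is 0 then 1%:M else
  - \sum_(l < size s) P (size s - l)%N *m nth 0 s l).
have [G hG] := strong_rec (fun s : seq mx => if size s is 0 then 1%:M else
  - \sum_(l < size s) nth 0 s l *m P (size s - l)%N).
have HE m : H m.+1 = - \sum_(l < m.+1) P (m.+1 - l)%N *m H l.
  rewrite hH size_mkseq; congr (- _); apply: eq_bigr => l _.
  by rewrite (nth_mkseq _ _ (ltn_ord l)).
have GE m : G m.+1 = - \sum_(l < m.+1) G l *m P (m.+1 - l)%N.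
  rewrite hG size_mkseq; congr (- _); apply: eq_bigr => l _.
  by rewrite (nth_mkseq _ _ (ltn_ord l)).
have H0 : H 0%N = 1%:M by rewrite hH.
have G0 : G 0%N = 1%:M by rewrite hG.
have PH : mx_of_seq P *m mx_of_seq H = 1%:M.
  rewrite mx_of_seqM -mx_of_seq1; congr mx_of_seq; apply: funext => [[|m]].
    by rewrite big_ord1 P0 H0 mulmx1.
  rewrite (reindex_inj rev_ord_inj) /= big_ord_recr /= subnn subn0 P0 mul1mx HE.
  apply/eqP; rewrite subr_eq0; apply/eqP; apply: eq_bigr => l _.
  by rewrite subSS subKn // ltnW // ltnS ltnW.
have GP : mx_of_seq G *m mx_of_seq P = 1%:M.
  rewrite mx_of_seqM -mx_of_seq1; congr mx_of_seq; apply: funext => [[|m]].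
    by rewrite big_ord1 P0 G0 mulmx1.
  by rewrite big_ord_recr /= subnn P0 mulmx1 GE subrr.
have GH : mx_of_seq G = mx_of_seq H by rewrite -[LHS]mulmx1 -PH mulmxA GP mul1mx.
exists (mx_of_seq H); split=> //; last by rewrite -GH.
apply: even_mx_of_seq => m; elim/ltn_ind: m => [[|m]] IH; first by rewrite H0;
  apply: even_mx1.
move=> i j; rewrite HE mxE summxE; apply: homogN; apply: homog_sum => l _.
exact: (even_mulmx (eP _) (IH _ (ltn_ord l))).
Qed.

(* diag(0, 1, 2, ...) + s M over A[[s]]. *)
Definition perturb M : fmx := mx_of_seq (fun m =>
  if m is 0 then \matrix_(i, j) ((i : nat) * (i == j))%:R else
  if m is 1 then M else 0).

(** At order m+1 and position i <> j the unknown entry of P is multiplied by i - j, a nonzero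
    integer and so invertible in K. The diagonal of P is normalized to 1, which leaves (M P_m)_jj as
    the coefficient of L. *)
Lemma perturb_diagonalizable M : even_mx gr M ->
  exists P Q L : fmx, [/\ even_mx grf P, even_mx grf Q, even_mx grf L,
    is_diag_mx L & Q *m P = 1%:M /\ perturb M = P *m L *m Q].
Proof.
move=> hM.
pose Ld (s : nat -> mx) l j : A := if l is l'.+1 then (M *m s l') j j else j%:R.
(* Order by order in s, the equation (D + s M) P = P L determines the diagonal
   part of L and the off-diagonal part of P. *)
pose step (s : nat -> mx) m i j : A := if i == j then 0 else
  (i%:R - j%:R : K)^-1 *:
    (\sum_(l < m) s l.+1 i j * Ld s (m - l)%N j - (M *m s m) i j).
have [P hP] := strong_rec (fun s : seq mx => if size s is m.+1 then
  \matrix_(i, j) step (nth 0 s) m i j else 1%:M).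
have P0 : P 0%N = 1%:M by rewrite hP.
have PE m i j : P m.+1 i j = step P m i j.
  rewrite hP size_mkseq mxE /step; case: eqP => // _; congr (_ *: (_ - _)).
    apply: eq_bigr => l _; rewrite nth_mkseq // ?ltnS //; congr (_ * _).
    rewrite /Ld; case E: (m - l)%N => [//|l'].
    rewrite nth_mkseq // (leq_trans (n := (m - l)%N)) ?E //.
    by rewrite -E (leq_trans (leq_subr _ _)).
  by rewrite nth_mkseq.
have eP : even_seq P.
  move=> m; elim/ltn_ind: m => [[|m]] IH; first by rewrite P0; apply: even_mx1.
  move=> i j; rewrite PE /step; case: eqP => [_|_]; first exact: homog0.
  rewrite -[_ *: _]addr0; apply: homogP; last exact: homog0.
  have IH' l : (l <= m)%N -> even_mx gr (P l) by move=> lm; apply: IH.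
  apply: homogB; last exact: (even_mulmx hM (IH' _ _)).
  apply: homog_sum => l _; rewrite -[par i (+) par j]addbF; apply: homogM.
    by apply: IH'.
  rewrite /Ld; case E: (m - l)%N => [|l']; first exact: homog_nat.
  rewrite -(addbb (par j)); apply: (even_mulmx hM (IH' _ _)).
  by rewrite ltnW // -E leq_subr.
pose Ls m : mx := \matrix_(i, j) (if i == j then Ld P m j else 0).
have eL : even_seq Ls.
  move=> m i j; rewrite mxE; case: eqP => [->|_]; last exact: homog0.
  case: m => [|m] /=; first by rewrite addbb; apply: homog_nat.
  exact: (even_mulmx hM (eP m)).
have [Q [eQ PQ QP]] := mx_of_seq_inv P0 eP.
exists (mx_of_seq P), Q, (mx_of_seq Ls); split; try exact: even_mx_of_seq;
  first exact: eQ.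
  apply/is_diag_mxP => i j ij; rewrite mxE; apply: funext => m; rewrite mxE.
  by rewrite -val_eqE /= (negPf ij).
split=> //;
  suff -> : mx_of_seq P *m mx_of_seq Ls = perturb M *m mx_of_seq P by rewrite -mulmxA
    PQ mulmx1.
rewrite /perturb !mx_of_seqM; congr mx_of_seq; apply: funext => m; apply/matrixP => i j.
have PL l l' : (P l *m Ls l') i j = P l i j * Ld P l' j.
  rewrite mxE (bigD1 j) //= mxE eqxx big1 ?addr0 // => k kj.
  by rewrite mxE (negPf kj) mulr0.
have DP l : ((\matrix_(i, j) ((i : nat) * (i == j))%:R : mx) *m P l) i j = i%:R * P l
  i j.
  rewrite mxE (bigD1 i) //= mxE eqxx muln1 big1 ?addr0 // => k ki.
  by rewrite mxE eq_sym (negPf ki) muln0 mul0r.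
rewrite !summxE; under eq_bigr => l _ do rewrite PL.
case: m => [|m].
  rewrite !big_ord1 /= DP P0 mxE; case: eqP => [->|_].
    by rewrite mul1r mulr1.
  by rewrite mul0r mulr0.
(* Only the constant term D and the linear term M of [perturb M] contribute. *)
rewrite [in RHS]big_ord_recl [in RHS]big_ord_recl /= DP subn0 [X in _ = _ + (_ +
  X)]big1 ?addr0; last first.
  by move=> l _; rewrite ?/bump /= ?add1n /= mul0mx mxE.
rewrite /bump /= addn0 subSS subn0.
rewrite big_ord_recl big_ord_recr /= /bump /= add1n subnn.
under eq_bigr => l _ do rewrite /bump /= add1n subSS.
rewrite P0 mxE !PE /step; case: (eqVneq i j) => [->|ij].
  rewrite big1 ?mul0r ?add0r ?addr0 ?mulr0 ?mul1r ?add0r //.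
  by move=> l _; rewrite PE /step eqxx mul0r.
rewrite mul0r add0r; set S := \sum_(l < m) _; set c := (M *m P m) i j.
have kn0 : (i%:R - j%:R : K) != 0.
  by rewrite subr_eq0 Num.Theory.eqr_nat.
set e := _ *: (S - c).
have he : i%:R *: e - j%:R *: e = S - c.
  by rewrite -scalerBl scalerA mulfV ?scale1r.
rewrite mulr_natr mulr_natl -!scaler_nat.
have -> : i%:R *: e = S - c + j%:R *: e by rewrite -he subrK.
by rewrite addrAC subrK.
Qed.

End Diagonalization.

(** * Hankel determinants *)

Section EvenSubring.
Context {K : nzRingType} {A : algType K} (gr : supercommutative A).

(** [homog] is a proposition; its boolean form yields a subring type, commutative by
    supercommutativity, where adjugates are available. *)
Definition even_elt : {pred A} := fun x => `[< homog gr false x >].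

Lemma even_eltP x : reflect (homog gr false x) (x \in even_elt).
Proof. exact: asboolP. Qed.

Fact even_subring : subring_closed even_elt.
Proof.
split=> [|x y /even_eltP hx /even_eltP hy|x y /even_eltP hx /even_eltP hy];
  apply/even_eltP.
- exact: homog1.
- exact: homogB.
exact: (homogM hx hy).
Qed.

HB.instance Definition _ := GRing.isSubringClosed.Build A even_elt even_subring.

Record evenT := Even { even_val :> A; _ : even_val \in even_elt }.
HB.instance Definition _ := [isSub for even_val].
HB.instance Definition _ := [Choice of evenT by <:].
HB.instance Definition _ := [SubChoice_isSubNzRing of evenT by <:].

Fact even_mulC : @commutative evenT evenT *%R.
Proof.
move=> [x hx] [y hy]; apply: val_inj; rewrite !rmorphM /=.
by rewrite (supercomm (even_eltP _ hx) (even_eltP _ hy)) mul1r.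
Qed.

HB.instance Definition _ := GRing.PzRing_hasCommutativeMul.Build evenT even_mulC.

End EvenSubring.

Lemma det_rmorph (R S : nzRingType) (f : {rmorphism R -> S}) n (H : 'M[R]_n) :
  \det (map_mx f H) = f (\det H).
Proof.
rewrite /determinant rmorph_sum; apply: eq_bigr => s _.
rewrite rmorphM rmorph_sign rmorph_prod; congr (_ * _).
by apply: eq_bigr => i _; rewrite mxE.
Qed.

(** The recurrence is a kernel vector of the Hankel matrix whose last entry is [Q 0] = 1.
    Multiplying by the adjugate kills the determinant even when R has zero divisors. *)
Lemma hankel_det0 (R : comNzRingType) (q : nat) (p k : int) (c : int -> R) (Q : nat
  -> R) :
  Q 0%N = 1 ->
  (forall n : int, p < n -> \sum_(j < q.+1) Q j * c (n - j%:Z) = 0) ->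
  p - q%:Z < k ->
  \det (\matrix_(i < q.+1, j < q.+1) c (k + (i : nat)%:Z + (j : nat)%:Z)) = 0.
Proof.
move=> Q0 hc hk; set H := \matrix_(_, _) _.
pose x : 'cV[R]_q.+1 := \col_j Q (q - j)%N.
have Hx : H *m x = 0.
  apply/colP => i; rewrite !mxE.
  (* Row i uses the recurrence at index k + i + q, which exceeds p exactly because k > p - q when i
     = 0. *)
  rewrite -[RHS](hc (k + (i : nat)%:Z + q%:Z)); last by lia.
  rewrite [LHS](reindex_inj rev_ord_inj) /=; apply: eq_bigr => j _.
  rewrite !mxE mulrC /= subSS subKn; last by rewrite -ltnS.
  by congr (_ * c _); have := ltn_ord j; lia.
have : (\adj H *m H) *m x = 0 by rewrite -mulmxA Hx mulmx0.
rewrite mul_adj_mx mul_scalar_mx => /colP /(_ ord_max).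
by rewrite !mxE /= subnn Q0 mulr1.
Qed.

(** * Generating function of canonical words *)

Section GeneratingFunction.
Context {R : comNzRingType} {p q : nat} (a : 'I_(p + q) -> R).
Local Notation I := 'I_(p + q).
Local Notation par := (@par p q).
Implicit Types (i j : I) (w : seq I).

Lemma canon_cons i w :
  canon (i :: w) = [&& canon w, all (leI i) w & par i || (i \notin w)].
Proof.
rewrite /canon even_uniq_cons /= path_sortedE; last exact: leI_trans.
by case: (all _ w) (sorted _ w) (even_uniq w) (par i || _) => [] [] [] [].
Qed.

(* The power series in z equal to the product over the letters i >= m of (1 + a_i z)
   for i even and of (1 - a_i z)^-1 for i odd. *)
Definition canon_gen m : fps R := fun k =>
  \sum_(u : k.-tuple I | canon u && all (fun i : I => m <= i)%N u) \prod_(i <- u) a i.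

Definition fps_lin (c : R) : fps R := fun n => if n is n'.+1 then if n' is 0 then c
  else 0 else 1.

Lemma fps_lin_mul0 c f : (fps_lin c * f) 0%N = f 0%N.
Proof. by rewrite fps_coefM big_ord1 mul1r. Qed.

Lemma fps_lin_mulS c f k : (fps_lin c * f) k.+1 = f k.+1 + c * f k.
Proof.
rewrite fps_coefM !big_ord_recl big1 ?addr0 /=;
  first by rewrite mul1r subn0 /bump /= addn0 subSS subn0.
by move=> i _; rewrite mul0r.
Qed.

Lemma canon_gen0 m : canon_gen m 0%N = 1.
Proof.
rewrite /canon_gen big_mkcond (big_tuple0 (fun u => if canon u && all _ u then
  \prod_(i <- u) a i else 0)).
by rewrite /= big_nil.
Qed.

Lemma canon_genS m k : canon_gen m k.+1 = \sum_(i : I | (m <= i)%N) a i *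
  \sum_(w : k.-tuple I | [&& canon w, all (leI i) w & par i || (i \notin tval w)])
     \prod_(j <- w) a j.
Proof.
rewrite /canon_gen big_mkcond.
rewrite (big_tupleS _ (fun u => if canon u && all (fun i : I => m <= i)%N u then
  \prod_(i <- u) a i else 0)).
rewrite [RHS]big_mkcond /=; apply: eq_bigr => i _.
case: leqP => mi; last first.
  by rewrite big1 // => w _; rewrite andbF.
rewrite [in RHS]big_mkcond /= mulr_sumr; apply: eq_bigr => w _;
  rewrite canon_cons /= big_cons.
case cw: [&& _, _ & _]; rewrite /= ?mulr0 //.
suff -> : all (fun j : I => m <= j)%N w by [].
case/and3P: cw => _ /allP iw _; apply/allP => j /iw; exact: leq_trans.
Qed.

(** A word either avoids the letter m or starts with it; an even m then does not occur again. *)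
Lemma canon_gen_even m (hm : (m < p + q)%N) : (m < p)%N ->
  canon_gen m = fps_lin (a (Ordinal hm)) * canon_gen m.+1.
Proof.
move=> mp; apply: funext => [[|k]]; first by rewrite fps_lin_mul0 !canon_gen0.
rewrite fps_lin_mulS !canon_genS (bigD1 (Ordinal hm)) //= addrC; congr (_ + _ * _).
  by apply: eq_bigl => i; rewrite -val_eqE /= ltn_neqAle eq_sym andbC.
apply: eq_bigl => w; case: (canon w) => //=.
rewrite /Defs.par /= leqNgt mp /=; elim: (tval w) => //= j w' <-.
rewrite inE negb_or /leI -val_eqE /= ltn_neqAle.
by case: (m == j) (m <= j)%N (all _ _) => [] [] [] //=; rewrite ?andbF.
Qed.

(** After an odd first letter m the rest may start with m again, so these words contribute a_m z
    times the whole series, as in a geometric series. *)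
Lemma canon_gen_odd m (hm : (m < p + q)%N) : (p <= m)%N ->
  fps_lin (- a (Ordinal hm)) * canon_gen m = canon_gen m.+1.
Proof.
move=> mp; apply: funext => [[|k]]; first by rewrite fps_lin_mul0 !canon_gen0.
rewrite fps_lin_mulS !canon_genS (bigD1 (Ordinal hm)) //=.
set S := \sum_(w | _) _; have -> : S = canon_gen m k.
  apply: eq_bigl => w; case: (canon w) => //=.
  by rewrite /Defs.par /= mp andbT.
rewrite mulNr addrAC subrr add0r.
by apply: eq_bigl => i; rewrite -val_eqE /= ltn_neqAle eq_sym andbC.
Qed.

Lemma canon_gen_top : canon_gen (p + q) = 1.
Proof.
apply: funext => [[|k]]; first by rewrite canon_gen0.
by rewrite canon_genS big1 // => i; rewrite leqNgt ltn_ord.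
Qed.

Lemma canon_gen_rational m : (m <= p + q)%N ->
  (\prod_(i : I | (m <= i)%N && par i) fps_lin (- a i)) * canon_gen m =
  \prod_(i : I | (m <= i)%N && ~~ par i) fps_lin (a i).
Proof.
move: {2}(p + q - m)%N (erefl (p + q - m)%N) => d; elim: d m => [|d IH] m dm mn.
  have -> : m = (p + q)%N by lia.
  rewrite canon_gen_top mulr1 !big_pred0 // => i; by rewrite leqNgt ltn_ord.
have hm : (m < p + q)%N by lia.
have spl (P : pred I) (F : I -> fps R) : \prod_(i : I | (m <= i)%N && P i) F i =
    (if P (Ordinal hm) then F (Ordinal hm) else 1) * \prod_(i : I | (m < i)%N && P i)
      F i.
  have E i : (m < i)%N && P i = ((m <= i)%N && P i) && (i != Ordinal hm).
    by rewrite -val_eqE /= ltn_neqAle eq_sym [RHS]andbC andbA.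
  under [in RHS]eq_bigl do rewrite E.
  case: ifP => hP; first by rewrite (bigD1 (Ordinal hm)) //= leqnn hP.
  rewrite mul1r; apply: eq_bigl => i; case: eqVneq => [->|_];
    by rewrite ?hP ?andbF ?andbT.
have := IH m.+1; rewrite !spl => IH'; rewrite {1 3}/Defs.par /=.
case: (leqP p m) => mp /=.
  rewrite mul1r -(IH' _ hm); last by lia.
  by rewrite -(canon_gen_odd hm mp) mulrA [fps_lin _ * _]mulrC.
by rewrite mul1r (canon_gen_even hm mp) mulrCA IH' //; lia.
Qed.

Lemma prod_fps_lin_deg (P : pred I) (b : I -> R) n :
  (\sum_(i | P i) 1 < n)%N -> (\prod_(i | P i) fps_lin (b i) : fps R) n = 0.
Proof.
elim/big_rec2: _ n => [|i d f _ IH] n; first by case: n.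
case: n => // n; rewrite add1n ltnS fps_lin_mulS => dn.
by rewrite !IH ?mulr0 ?addr0 // ltnW.
Qed.

Lemma prod_fps_lin0 (P : pred I) (b : I -> R) : (\prod_(i | P i) fps_lin (b i) : fps
  R) 0%N = 1.
Proof. by elim/big_rec: _ => // i f _ IH; rewrite fps_lin_mul0. Qed.

Definition canon_genz (n : int) : R := if n is Posz k then canon_gen 0 k else 0.

Lemma canon_genz_hankel (k : int) : p%:Z - q%:Z < k ->
  \det (\matrix_(i < q.+1, j < q.+1) canon_genz (k + (i : nat)%:Z + (j : nat)%:Z)) = 0.
Proof.
pose Q : fps R := \prod_(i : I | par i) fps_lin (- a i).
apply: (@hankel_det0 _ _ _ _ canon_genz Q); first exact: prod_fps_lin0.
case=> // N; rewrite ltz_nat => pN.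
pose T (j : nat) := Q j * canon_genz (N%:Z - j%:Z).
have cardE (b : bool) : (\sum_(i : I | par i == b) 1 = if b then q else p)%N.
  rewrite big_split_ord /= /Defs.par /=.
  under eq_bigl => i do rewrite leqNgt ltn_ord /=.
  under [X in (_ + X)%N]eq_bigl => i do rewrite leq_addr /=.
  by case: b => /=; rewrite big_pred0_eq sum1_card card_ord ?addn0.
have Qdeg (j : nat) : (q < j)%N -> Q j = 0.
  move=> qj; apply: prod_fps_lin_deg; under eq_bigl do rewrite -[par _]eqb_id.
  by rewrite cardE.
have sumT n d : (forall j : nat, (n <= j)%N -> T j = 0) ->
    \sum_(j < n) T j = \sum_(j < n + d) T j.
  move=> hT; rewrite big_split_ord /= [X in _ = _ + X]big1 ?addr0 //.
  by move=> j _; rewrite hT // leq_addr.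
transitivity (\sum_(j < q.+1) T j); first by [].
(* Both sums are extended to a common range: Q has degree at most q, and [canon_genz] vanishes at
   the negative index N - j when j > N. *)
rewrite (sumT _ N.+1); last by move=> j qj; rewrite /T Qdeg ?mul0r.
rewrite addnC -sumT; last first.
  move=> j Nj; rewrite /T; have -> : N%:Z - j%:Z = Negz (j - N).-1 by lia.
  by rewrite mulr0.
transitivity ((Q * canon_gen 0) N).
  rewrite fps_coefM; apply: eq_bigr => j _; rewrite /T.
  by rewrite subzn // -ltnS.
rewrite (canon_gen_rational (leq0n _)) /=; apply: prod_fps_lin_deg.
under eq_bigl => i do rewrite -eqbF_neg.
by rewrite cardE.
Qed.

End GeneratingFunction.

Section Hankel.
Context {K : numFieldType} {A : algType K} (gr : supercommutative A) {p q : nat}.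
Local Notation I := 'I_(p + q).
Local Notation par := (@par p q).
Local Notation wpar := (@wpar p q).
Implicit Types (i j : I) (u v w : seq I) (M L : 'M[A]_(p + q)).

Definition ext_strz M (k : int) : A := if k is Posz n then ext_str gr n M else 0.

Lemma prod_sign_wpar (b : I -> A) u :
  \prod_(i <- u) ((-1) ^+ par i * b i) = (-1) ^+ wpar u * \prod_(i <- u) b i.
Proof.
elim: u => [|i u IH]; first by rewrite !big_nil mul1r.
rewrite !big_cons IH wpar_cons signr_addb !mulrA; congr (_ * _).
by rewrite -!mulrA commr_sign.
Qed.

(** A diagonal operator only has diagonal terms on words, and the sign of a word is the product over
    its letters; so odd eigenvalues enter with opposite sign. *)
Lemma ext_str_diag k L : even_mx gr L -> is_diag_mx L ->
  ext_str gr k L = \sum_(u : k.-tuple I | canon u) \prod_(i <- u) ((-1) ^+ par i * L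
    i i).
Proof.
move=> eL dL; rewrite /ext_str [RHS]big_mkcond /=; apply: eq_bigr => u _.
rewrite (@big_tuple_eq _ _ _ (fun w => nf_mx u w * tmap_mx gr L w u) u) ?size_tuple
  //; last first.
  by move=> w /negPf wu; rewrite tmap_mx_diag // wu mul0r mulr0.
rewrite tmap_mx_diag // eqxx mul1r prod_sign_wpar; case: ifPn => cu.
  by rewrite nf_mx_canon // eqxx mul1r.
have -> : nf_mx (tval u) u = 0 :> A; last by rewrite mul0r mulr0.
have := nf_canon (tword (tval u) (1 : A)) cu; rewrite nf_tword // mulr1; exact.
Qed.

Lemma ext_strz_hankel_diag L (k : int) : even_mx gr L -> is_diag_mx L ->
  p%:Z - q%:Z < k ->
  \det (\matrix_(i < q.+1, j < q.+1) ext_strz L (k + (i : nat)%:Z + (j : nat)%:Z)) = 0.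
Proof.
move=> eL dL hk.
have ha i : (-1) ^+ par i * L i i \in even_elt gr.
  by apply/even_eltP; apply: homog_sign; have := eL i i; rewrite addbb.
pose a i := Even (ha i).
have canon_genE n : val (canon_genz a n) = ext_strz L n.
  case: n => n; last exact: (raddf0 (val : {rmorphism evenT gr -> A})).
  change (val (canon_gen a 0 n) = ext_str gr n L); rewrite ext_str_diag // /canon_gen.
  rewrite (raddf_sum (val : {rmorphism evenT gr -> A})) /=.
  apply: eq_big => [u|u _]; first by rewrite all_predT andbT.
  exact: (rmorph_prod (val : {rmorphism evenT gr -> A})).
pose f : {rmorphism evenT gr -> A} := (val : {rmorphism evenT gr -> A}).
pose H := \matrix_(i < q.+1, j < q.+1) canon_genz a (k + (i : nat)%:Z + (j : nat)%:Z).
transitivity (f (\det H)); last by rewrite (canon_genz_hankel a hk); apply: raddf0.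
rewrite -(det_rmorph f); congr determinant; apply/matrixP => i j.
by rewrite !mxE -canon_genE.
Qed.

End Hankel.

(** * Descent from the perturbed matrix by top coefficients *)

Section TopCoefficient.
Context {K : numFieldType} {A : algType K} (gr : supercommutative A) {p q : nat}.
Local Notation I := 'I_(p + q).
Local Notation grf := (fps_super gr).
Implicit Types (f g : fps A) (x y : A) (M : 'M[A]_(p + q)) (u v w : seq I).

(* x may be 0: n only bounds the degree of f as a polynomial in s. *)
Definition top_coef (n : int) f x :=
  (forall m : nat, n < m -> f m = 0) /\ (if n is Posz m then f m = x else x = 0).

Lemma top_coef0 n : top_coef n 0 0.
Proof. by split=> //; case: n. Qed.

Lemma top_coefD n f g x y : top_coef n f x -> top_coef n g y -> top_coef n (f + g) (x
  + y).
Proof.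
case=> f0 fx [g0 gy]; split=> [m nm|]; first by rewrite fps_coefD f0 // g0 // addr0.
by case: n {f0 g0} fx gy => n; rewrite ?fps_coefD => -> ->; rewrite ?addr0.
Qed.

Lemma top_coefN n f x : top_coef n f x -> top_coef n (- f) (- x).
Proof.
case=> f0 fx; split=> [m nm|]; first by rewrite fps_coefN f0 // oppr0.
by case: n {f0} fx => n; rewrite ?fps_coefN => ->; rewrite ?oppr0.
Qed.

Lemma top_coef_sign n f x (b : bool) : top_coef n f x -> top_coef n ((-1) ^+ b * f)
  ((-1) ^+ b * x).
Proof. by rewrite !mulr_sign; case: b => // /top_coefN. Qed.

Lemma top_coef_sum n (T : Type) (r : seq T) (P : pred T) (F : T -> fps A) (X : T -> A) :
  (forall t, P t -> top_coef n (F t) (X t)) ->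
  top_coef n (\sum_(t <- r | P t) F t) (\sum_(t <- r | P t) X t).
Proof.
by move=> h; elim/big_rec2: _ => [|t y f Pt IH]; [apply: top_coef0|apply: top_coefD;
  auto].
Qed.

(** A negative bound forces both the series and its coefficient to be zero, so the rule holds
    whatever the other bound. *)
Lemma top_coefM n m f g x y : top_coef n f x -> top_coef m g y -> top_coef (n + m) (f
  * g) (x * y).
Proof.
case: n => n [f0 fx]; last first.
  have -> : f = 0 by apply: funext => l; apply: f0.
  by rewrite mul0r fx mul0r => _; apply: top_coef0.
case: m => m [g0 gy]; last first.
  have -> : g = 0 by apply: funext => l; apply: g0.
  by rewrite mulr0 gy mulr0; apply: top_coef0.
(* From degree n + m on, the only product that may survive has i = n and l = n + m. *)
have E (l i : nat) : (n + m <= l)%N -> (i <= l)%N -> (i != n) || (l != n + m)%N ->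
    f i * g (l - i)%N = 0.
  move=> hl il h; case: (ltnP n i) => hi; first by rewrite f0 ?mul0r.
  by rewrite g0 ?mulr0 // ltz_nat; move: h => /orP [] /eqP; lia.
split=> [l|] /=.
  rewrite -PoszD ltz_nat => hl; rewrite fps_coefM big1 // => i _.
  by apply: E; [exact: ltnW | rewrite -ltnS | rewrite (gtn_eqF hl) orbT].
have hn : (n < (n + m).+1)%N by rewrite ltnS leq_addr.
rewrite fps_coefM (bigD1 (Ordinal hn)) //= addKn fx gy big1 ?addr0 // => i.
by rewrite -val_eqE /= => hi; apply: E => //; rewrite ?hi // -ltnS.
Qed.

Lemma top_coef1 : top_coef 0 1 1.
Proof. by split=> // [[|m]]. Qed.

Lemma top_coef_nat (n : nat) : top_coef 0 n%:R n%:R.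
Proof.
elim: n => [|n IH]; first exact: top_coef0.
by rewrite -addn1 !natrD; apply: top_coefD => //; apply: top_coef1.
Qed.

Lemma top_coef_supersign n d f x : top_coef n f x -> top_coef n (supersign grf d f)
  (supersign gr d x).
Proof.
case=> f0 fx; split=> [m nm|]; first by rewrite fps_supersign f0 // supersign0.
by case: n {f0} fx => n; rewrite ?fps_supersign => ->; rewrite ?supersign0.
Qed.

Lemma top_coef_perturb M i j : top_coef 1 (perturb M i j) (M i j).
Proof. by rewrite /perturb mxE; split=> // [[|[|m]]] // _; rewrite mxE. Qed.

(** Each letter of [u] contributes one entry of [perturb M], hence one degree. *)
Lemma top_coef_tmap_mx M u w : top_coef (size u) (tmap_mx grf (perturb M) u w)
  (tmap_mx gr M u w).
Proof.
elim: u w => [|i u IH] [|j w] /=; try exact: top_coef0; first exact: top_coef1.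
rewrite -addn1 PoszD addrC; apply: top_coefM => //.
exact/top_coef_supersign/top_coef_perturb.
Qed.

Lemma top_coef_nf_mx u w : top_coef 0 (nf_mx u w) (nf_mx u w).
Proof.
rewrite /nf_mx; rewrite -[0]addr0; apply: top_coefM; first exact: top_coef_nat.
rewrite /sort_sign -[0]addr0; apply: top_coefM; first exact: top_coef_nat.
by rewrite -[_ ^+ _ in X in top_coef _ X]mulr1 -[_ ^+ _ in X in top_coef _ _ X]mulr1;
  apply/top_coef_sign/top_coef1.
Qed.

Lemma top_coef_ext_strz M k : top_coef k (ext_strz grf (perturb M) k) (ext_strz gr M k).
Proof.
case: k => k; last exact: top_coef0.
apply: top_coef_sum => u _; apply: top_coef_sign; apply: top_coef_sum => w _.
rewrite -[Posz k]add0r; apply: top_coefM; first exact: top_coef_nf_mx.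
by have := top_coef_tmap_mx M w u; rewrite size_tuple.
Qed.

Lemma top_coef_prod (T : Type) (r : seq T) (n : T -> int) (F : T -> fps A) (X : T ->
  A) :
  (forall t, top_coef (n t) (F t) (X t)) ->
  top_coef (\sum_(t <- r) n t) (\prod_(t <- r) F t) (\prod_(t <- r) X t).
Proof.
move=> h; elim: r => [|t r IH]; first by rewrite !big_nil; apply: top_coef1.
by rewrite !big_cons; apply: top_coefM.
Qed.

Lemma top_coef_hankel (F : int -> fps A) (X : int -> A) n k : (forall l, top_coef l
  (F l) (X l)) ->
  top_coef (\sum_(i < n) (k + (i : nat)%:Z + (i : nat)%:Z))
    (\det (\matrix_(i < n, j < n) F (k + (i : nat)%:Z + (j : nat)%:Z)))
    (\det (\matrix_(i < n, j < n) X (k + (i : nat)%:Z + (j : nat)%:Z))).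
Proof.
move=> h; apply: top_coef_sum => s _; apply: top_coef_sign.
(* Reindexing by [s] shows that all terms of the determinant have the same degree bound. *)
have -> : \sum_(i < n) (k + (i : nat)%:Z + (i : nat)%:Z) =
    \sum_(i < n) (k + (i : nat)%:Z + ((s : {perm 'I_n}) i : nat)%:Z).
  rewrite !big_split /=; congr (_ + _).
  by rewrite (reindex_inj (@perm_inj _ s)).
by apply: top_coef_prod => i; rewrite !mxE.
Qed.

Lemma top_coef_eq0 n x : top_coef n 0 x -> x = 0.
Proof. by case=> _; case: n. Qed.

Lemma ext_strz_hankel M (k : int) : even_mx gr M -> p%:Z - q%:Z < k ->
  \det (\matrix_(i < q.+1, j < q.+1) ext_strz gr M (k + (i : nat)%:Z + (j : nat)%:Z))
    = 0.
Proof.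
move=> hM hk; have h := top_coef_hankel q.+1 k (top_coef_ext_strz M);
  apply: (top_coef_eq0 (n := _)).
have [P [Q [L [eP eQ eL dL [QP XE]]]]] := perturb_diagonalizable hM.
(* [perturb M] is conjugate to the diagonal matrix L, so its determinant is the zero series required
   by [top_coef_eq0]. *)
move: h; congr top_coef; rewrite -[RHS](ext_strz_hankel_diag eL dL hk).
congr determinant; apply/matrixP => i j; rewrite !mxE XE /ext_strz.
by case: (_ + _ + _) => // n; rewrite ext_str_conj.
Qed.

End TopCoefficient.

Theorem mainTheorem2 (R : realType) (A : algType (complex R))
    (gr : supercommutative A) (p q : nat) (M : 'M[A]_(p + q))
    (M_even : even_mx gr M) (k : int) (hk : p%:Z - q%:Z < k) :
  \det (\matrix_(i < q.+1, j < q.+1)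
          ext_trace gr M (k + (i : nat)%:Z + (j : nat)%:Z)) = 0.
Proof.
rewrite -[RHS](ext_strz_hankel M_even hk); congr determinant.
apply/matrixP => i j; rewrite !mxE /ext_strz.
by case: (_ + _ + _) => // n; rewrite ext_trace_nat.
Qed.
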